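(* Let $x,y,n$ be nonnegative integers and let $U=\{s_1<\dots<s_u\}$, $D=\{t_1<\dots<t_d\}$, $U'=\{s'_1<\dots<s'_{u'}\}$, $D'=\{t'_1<\dots<t'_{d'}\}$ be subsets of $[x+y+n]=\{1,\dots,x+y+n\}$ such that $|U\cup D|=n$, $U\cup D=U'\cup D'$ and $U\cap D=U'\cap D'$ (so $u,d,u',d'\le n$). Let $B\subseteq[x+y+n]\setminus(U\cup D)$ with $|B|\le x$. Then $$\frac{\operatorname{M}(W_{x,y}(U;D;B))}{\operatorname{M}(W_{x,y}(U';D';B))}=\frac{\prod_{1\le i<j\le u}(s_j-s_i)\prod_{1\le i\le j\le u}(s_i+s_j-1)\prod_{1\le i<j\le d}(t_j-t_i)\prod_{1\le i\le j\le d}(t_i+t_j-1)}{\prod_{1\le i<j\le u'}(s'_j-s'_i)\prod_{1\le i\le j\le u'}(s'_i+s'_j-1)\prod_{1\le i<j\le d'}(t'_j-t'_i)\prod_{1\le i\le j\le d'}(t'_i+t'_j-1)}\cdot\frac{\mathbf{H}_2(2u'+2y+1)\,\mathbf{H}_2(2d'+2y+1)}{\mathbf{H}_2(2u+2y+1)\,\mathbf{H}_2(2d+2y+1)}$$ and (whenever the regions $\overline{W}$ below are defined) $$\frac{\operatorname{M}(\overline{W}_{x,y}(U;D;B))}{\operatorname{M}(\overline{W}_{x,y}(U';D';B))}=\frac{\prod_{1\le i<j\le u}(s_j-s_i)(s_j+s_i-2)\prod_{1\le i<j\le d}(t_j-t_i)(t_j+t_i-2)}{\prod_{1\le i<j\le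 u'}(s'_j-s'_i)(s'_j+s'_i-2)\prod_{1\le i<j\le d'}(t'_j-t'_i)(t'_j+t'_i-2)}\cdot\frac{\mathbf{H}_2(2u'+2y)\,\mathbf{H}_2(2d'+2y)}{\mathbf{H}_2(2u+2y)\,\mathbf{H}_2(2d+2y)}.$$
   Context: Work on the triangular lattice drawn so that one family of lattice lines is horizontal; unit triangles are up-pointing or down-pointing. A lozenge is the union of two unit triangles sharing an edge; a vertical lozenge is one formed by an up-pointing triangle and the down-pointing triangle directly below it sharing its horizontal edge. Lozenges may carry weights; for a region $R$, $\operatorname{M}(R)$ is the sum over all lozenge tilings of $R$ (respecting barriers) of the product of the weights of the lozenges in the tiling (unweighted lozenges have weight 1). The halved hexagon $F_{x,y}(U;D;B)$ (with $u=|U|$, $d=|D|$, $n=|U\cup D|$): take the lattice region whose boundary consists of a horizontal north side of length $x+n-u$; from its east end a north-east side of length $2y+2u$ running down and to the right; then a south-east side of length $2y+2d$ running down and to the left; a horizontal south side of length $x+n-d$; and a west side which, starting from the west end of the north side and going down, is a zigzag lattice path of $4y+2u+2d$ unit segments alternately going south-west and south-east, beginning with a south-west step. Let $l$ be the horizontal lattice line through the east vertex; its portion in the region has $x+y+n$ unit segments, numbered $1,\dots,x+y+n$ from west to east. Remove, for each $s\in U$, the up-pointing unit triangle whose base is the $s$-th segment of $l$, and for each $t\in D$, the down-pointing unit triangle whose top side is the $t$-th segment of $l$. For each $k\in B$ place a barrier at the $k$-th segment of $l$: tilings may not contain the vertical lozenge consisting of the two unit triangles sharing that segment. The region $\overline{F}_{x,y}(U;D;B)$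 is defined identically except that the north-east side has length $2y+2u-1$, the south-east side has length $2y+2d-1$, and the west zigzag has $4y+2u+2d-2$ unit segments (starting with a south-west step from the north-west corner and alternating); $l$ again is the horizontal line through the east vertex with $x+y+n$ unit segments in the region numbered from west to east. $W_{x,y}(U;D;B)$ and $\overline{W}_{x,y}(U;D;B)$ are the regions $F_{x,y}(U;D;B)$ and $\overline{F}_{x,y}(U;D;B)$, respectively, in which every vertical lozenge lying along the west side (i.e. whose two western edges are a consecutive south-west step followed by a south-east step of the west zigzag boundary) is given weight $\tfrac12$; all other lozenges have weight 1. The skipping hyperfactorial is $\mathbf{H}_2(2k)=0!\,2!\,4!\cdots(2k-2)!$ and $\mathbf{H}_2(2k+1)=1!\,3!\,5!\cdots(2k-1)!$. *)

(* Defs.v *)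
From mathcomp Require Import all_boot all_order all_algebra.
From mathcomp Require Import zify.

Set Implicit Arguments.
Unset Strict Implicit.
Unset Printing Implicit Defensive.

Import Order.TTheory GRing.Theory Num.Theory.
Local Open Scope ring_scope.

(* Coordinates.  Horizontal lattice lines are numbered 0, 1, 2, ... downwards
   from the north side, and horizontal positions are measured in half-units
   from the north-west corner, which is the vertex (0, 0); the lattice vertices
   are the (j, p) with j + p even.  The unit triangles between lines j and j+1
   are indexed by the position c of the midpoint of their horizontal side:
   the triangle (j, c) points up when j + c is even, down when j + c is odd.

   N, a and b are the lengths of the north, north-east and south-east sides;
   the west zigzag then has a + b segments and the length of the south side is
   determined. *)

(* Position reached after j steps SW, SE, SW, ... from the north-west corner. *)
Definition west (j : nat) : int := - (odd j)%:Z.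

Definition east (N a j : nat) : int :=
  if (j <= a)%N then (N.*2 + j)%:Z else (N.*2 + a.*2)%:Z - j%:Z.

Definition up (t : nat * int) : bool := ~~ odd (t.1 + `|t.2|).

Definition vertices (t : nat * int) : seq (nat * int) :=
  let: (j, c) := t in
  if up t then [:: (j, c); (j.+1, c - 1); (j.+1, c + 1)]
  else [:: (j, c - 1); (j, c + 1); (j.+1, c)].

(* The rows of the outline are convex, so a unit triangle lies inside it as soon
   as its vertices do. *)
Definition inside (N a b : nat) (t : nat * int) : bool :=
  (t.1 < a + b)%N &&
  all (fun v : nat * int => west v.1 <= v.2 <= east N a v.1) (vertices t).

(* A finite box containing all the unit triangles of the outline
   (inside_box below). *)
Definition tri (N a b : nat) : finType := ('I_(a + b) * 'I_(N.*2 + a))%type.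

Definition pos (N a b : nat) (t : tri N a b) : nat * int :=
  (nat_of_ord t.1, (nat_of_ord t.2)%:Z).

(* Midpoint of the k-th segment (k >= 1) of the line l, which is line a. *)
Definition midseg (a k : nat) : int := west a + k.*2%:Z - 1.

Definition above (a k : nat) (t : nat * int) : bool :=
  (t.1.+1 == a) && (t.2 == midseg a k).
Definition below (a k : nat) (t : nat * int) : bool :=
  (t.1 == a) && (t.2 == midseg a k).

(* Segments of l are 'I_m with label i.+1. *)
Definition seg (m : nat) (i : 'I_m) : nat := i.+1.

Definition region (N a b m : nat) (U D : {set 'I_m}) : {set tri N a b} :=
  [set t : tri N a b | [&& inside N a b (pos t),
     ~~ [exists s in U, above a (seg s) (pos t)] &
     ~~ [exists s in D, below a (seg s) (pos t)]]].

(* vertical_pair t t': t points up and t' is the triangle directly below it. *)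
Definition vertical_pair (t t' : nat * int) : bool :=
  [&& up t, t'.1 == t.1.+1 & t'.2 == t.2].

Definition lozenge_pair (t t' : nat * int) : bool :=
  vertical_pair t t' ||
  [&& up t, t'.1 == t.1 & (t'.2 == t.2 - 1) || (t'.2 == t.2 + 1)].

Definition lozenge (N a b : nat) (L : {set tri N a b}) : bool :=
  [exists t, exists t', (L == [set t; t']) && lozenge_pair (pos t) (pos t')].

Definition barred (N a b m : nat) (B : {set 'I_m}) (L : {set tri N a b}) :=
  [exists t, exists t', [&& L == [set t; t'], vertical_pair (pos t) (pos t') &
     [exists k in B, above a (seg k) (pos t)]]].

(* The left vertices of the vertical lozenge with upper triangle (j, c) are
   (j, c), (j+1, c-1) and (j+2, c). *)
Definition along_west (N a b : nat) (L : {set tri N a b}) : bool :=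
  [exists t, exists t', [&& L == [set t; t'], vertical_pair (pos t) (pos t') &
     let: (j, c) := pos t in
     [&& west j == c, west j.+1 == c - 1 & west j.+2 == c]]].

Definition weight (N a b : nat) (L : {set tri N a b}) : rat :=
  if along_west L then 2^-1 else 1.

Definition tiling (N a b m : nat) (U D B : {set 'I_m})
    (P : {set {set tri N a b}}) : bool :=
  partition P (region N a b U D) &&
  [forall L in P, lozenge L && ~~ barred B L].

Definition tiling_sum (N a b m : nat) (U D B : {set 'I_m}) : rat :=
  \sum_(P : {set {set tri N a b}} | tiling U D B P) \prod_(L in P) weight L.

(* M(W_{x,y}(U;D;B)), where n is meant to be #|U :|: D|. *)
Definition MW (x y n : nat) (U D B : {set 'I_(x + y + n)}) : rat :=
  tiling_sum (x + n - #|U|) (2 * y + 2 * #|U|) (2 * y + 2 * #|D|) U D B.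

(* M(Wbar_{x,y}(U;D;B)); only meaningful when Wbar_defined. *)
Definition MWbar (x y n : nat) (U D B : {set 'I_(x + y + n)}) : rat :=
  tiling_sum (x + n - #|U|) (2 * y + 2 * #|U| - 1) (2 * y + 2 * #|D| - 1) U D B.

(* The side lengths 2y+2u-1 and 2y+2d-1 of Wbar are nonnegative. *)
Definition Wbar_defined (y m : nat) (U D : {set 'I_m}) : bool :=
  (1 <= 2 * y + 2 * #|U|)%N && (1 <= 2 * y + 2 * #|D|)%N.

(* 0! 2! ... (m-2)! for m even, 1! 3! ... (m-2)! for m odd. *)
Definition H2 (m : nat) : rat := \prod_(i < m./2) ((2 * i + odd m)`!)%:R.

Definition prod_sub (m : nat) (S : {set 'I_m}) : rat :=
  \prod_(i in S) \prod_(j in S | (seg i < seg j)%N) ((seg j)%:R - (seg i)%:R).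

Definition prod_add1 (m : nat) (S : {set 'I_m}) : rat :=
  \prod_(i in S) \prod_(j in S | (seg i <= seg j)%N)
    ((seg i)%:R + (seg j)%:R - 1).

Definition prod_sub_add2 (m : nat) (S : {set 'I_m}) : rat :=
  \prod_(i in S) \prod_(j in S | (seg i < seg j)%N)
    (((seg j)%:R - (seg i)%:R) * ((seg j)%:R + (seg i)%:R - 2%:R)).

Lemma inside_box (N a b : nat) (t : nat * int) :
  inside N a b t -> exists t' : tri N a b, pos t' = t.
Proof.
case: t => j c; rewrite /inside /vertices => /andP[/= ltj].
have [c0 lec] : (forall i, - 1 <= west i) /\ (forall i, east N a i <= (N.*2 + a)%:Z).
  split=> i; rewrite /west /east; first by case: odd.
  by case: leqP; lia.
move=> H; have {H} /andP[c1 c2] : 0 <= c < (N.*2 + a)%:Z.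
  move: H (c0 j) (c0 j.+1) (lec j) (lec j.+1).
  by case: up => /=; lia.
case: c c1 c2 => // c _ ltc.
by exists (Ordinal ltj, Ordinal (ltc : c < N.*2 + a)%N).
Qed.

(* Main.v *)
Require Import Defs.
From mathcomp Require Import all_boot all_order all_algebra.
From mathcomp Require Import perm zify ring lra.
Set Implicit Arguments.
Unset Strict Implicit.
Unset Printing Implicit Defensive.
Import Order.TTheory GRing.Theory Num.Theory.
Local Open Scope ring_scope.

(** A tiling is determined, along the line [l], by the set [S] of segments
    crossed by vertical lozenges; [#|S| = y], [S] avoids [U], [D] and [B], and
    the tilings above and below [l] are then independent.  Hence [M] is the sum
    over [S] of [psi (U :|: S) * psi (D :|: S)], up to a factor depending only
    on [S], where [psi V] counts the tilings of a half with the dents [V].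

    Sweeping a half row by row, the numbers of partial tilings are the maximal
    minors of a matrix on which each triangle pair acts by a column operation.
    At the end its entries are explicit odd or even polynomials in the segment
    number, so that [psi V] is a Vandermonde product over [V] divided by a
    hyperfactorial.  In [psi (U :|: S) * psi (D :|: S)] the factors mixing
    dents with [S] only depend on [U :|: D] and [U :&: D], so they leave the
    ratio together with the sum over [S]. *)

(** * Permanents *)

(** Minors enter without signs because a particle only moves from a slot to the adjacent one, which
    keeps the particles in order; alternation disposes of the states where the adjacent slot is
    taken. A swept row acts by partial sums, starting from the constant 1. The weight 1/2 keeps
    these sums symmetric: if a polynomial is even about the west end, its summation is odd about a
    point half a unit away precisely when the first term counts for half. Hence the entries are
    Newton products in the single quantity [node], and their determinants are of Vandermonde type.

    Dents would change the shape of a half and spoil a uniform sweep. So the missing triangles just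
    above [l], or just below it after reflection of the lower half, are put back and tied to pendant
    partners: the swept half is always complete, and a dent set merely selects columns of one
    matrix.

    Division being total, the ratio can be simplified only if the denominators are nonzero; the
    bound on [B] provides an admissible [S], and all terms are positive. *)

Lemma remC (T : eqType) (x y : T) (s : seq T) : rem x (rem y s) = rem y (rem x s).
Proof.
elim: s => //= z s IH.
case: (boolP (z == y)) => zy; case: (boolP (z == x)) => zx /=;
  rewrite ?zy ?zx ?(negPf zy) ?(negPf zx) ?IH //.
by rewrite -(eqP zy) -(eqP zx).
Qed.

Section Permanent.

Variables (T S : eqType) (w : T -> S -> rat).

(* The permanent of [w] on the index lists [us] and [ds]; it is 0 when their
   lengths differ. *)
Fixpoint pm (us : seq T) (ds : seq S) : rat :=
  if us is u :: us' then \sum_(d <- ds) w u d * pm us' (rem d ds)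
  else (ds == [::])%:R.

Lemma pm_perm_r us ds ds' : perm_eq ds ds' -> pm us ds = pm us ds'.
Proof.
elim: us ds ds' => [|u us IH] ds ds' e /=.
  by move/perm_size: e; case: ds ds' => [|? ?] [|? ?].
rewrite (perm_big ds') //; apply: eq_big_seq => d dds'; congr (_ * _).
apply: IH; rewrite -(perm_cons d).
rewrite (perm_trans _ (perm_to_rem dds')) // perm_sym.
by apply: (perm_trans _ (perm_to_rem _)); rewrite 1?perm_sym // (perm_mem e).
Qed.

(** Since [pm] recurses on its first list, independence of the order of [us] and the transposition
    rule are both derived from this expansion. *)
Lemma pm_expand_r us ds d : uniq us -> uniq ds -> d \in ds ->
  pm us ds = \sum_(u <- us) w u d * pm (rem u us) (rem d ds).
Proof.
elim: us ds => [|u us IH] ds /=; first by case: ds => // ? ?; rewrite big_nil.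
move=> /andP[uus uqus] uqds dds; rewrite big_cons eqxx (big_rem d) //=.
congr (_ + _); under [RHS]eq_big_seq => v vus.
  rewrite ifN; last by apply: contraNneq uus => ->.
  rewrite /= mulr_sumr; over.
rewrite exchange_big /=; apply: eq_big_seq => e ers.
have ed : e != d by move: ers; rewrite mem_rem_uniq // inE => /andP[].
rewrite (IH (rem e ds)) ?rem_uniq //; last first.
  by rewrite mem_rem_uniq // inE eq_sym ed.
by rewrite mulr_sumr; apply: eq_bigr => v _; rewrite remC mulrCA.
Qed.

Lemma pm_nil_r us : pm us [::] = (us == [::])%:R.
Proof. by case: us => //= u us; rewrite big_nil. Qed.

Lemma pm_perm_l us us' ds : uniq us -> uniq ds -> perm_eq us us' ->
  pm us ds = pm us' ds.
Proof.
elim: ds us us' => [|d ds IH] us us' uqus uqds e.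
  by rewrite !pm_nil_r; move/perm_size: e; case: us us' {uqus} => [|? ?] [|? ?].
have uqus' : uniq us' by rewrite -(perm_uniq e).
rewrite !(@pm_expand_r _ _ d) ?inE ?eqxx // (perm_big us') //.
apply: eq_big_seq => u uus'; congr (_ * _) => /=; rewrite eqxx.
move: uqds => /= /andP[_ uqds]; apply: IH; rewrite ?rem_uniq //.
rewrite -(perm_cons u).
rewrite (perm_trans _ (perm_to_rem uus')) // perm_sym.
by apply: (perm_trans _ (perm_to_rem _)); rewrite 1?perm_sym // (perm_mem e).
Qed.

Lemma pm_expand_l us ds u : uniq us -> uniq ds -> u \in us ->
  pm us ds = \sum_(d <- ds) w u d * pm (rem u us) (rem d ds).
Proof.
by move=> uqus uqds uus; rewrite (pm_perm_l uqus uqds (perm_to_rem uus)).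
Qed.

Lemma pm_forced us ds u d : uniq us -> uniq ds -> u \in us -> d \in ds ->
  {in us, forall v, v != u -> w v d = 0} ->
  pm us ds = w u d * pm (rem u us) (rem d ds).
Proof.
move=> uqus uqds uus dds w0; rewrite (pm_expand_r _ _ dds) // (big_rem u) //=.
rewrite big_seq big1 ?addr0 // => v; rewrite mem_rem_uniq // inE => /andP[vu vus].
by rewrite w0 ?mul0r.
Qed.

Lemma pm_isolated us ds d : uniq us -> uniq ds -> d \in ds ->
  {in us, forall v, w v d = 0} -> pm us ds = 0.
Proof.
move=> uqus uqds dds w0; rewrite (pm_expand_r _ _ dds) // big_seq big1 // => v vus.
by rewrite w0 ?mul0r.
Qed.

End Permanent.

Lemma eq_pm (T S : eqType) (w w' : T -> S -> rat) us ds :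
  {in us & ds, w =2 w'} -> pm w us ds = pm w' us ds.
Proof.
elim: us ds => //= u us IH ds e; apply: eq_big_seq => d dds.
rewrite e ?inE ?eqxx // IH // => v d' vus /mem_rem d'ds.
by rewrite e // inE vus orbT.
Qed.

Lemma pm_tr (T S : eqType) (w : T -> S -> rat) us ds : uniq us -> uniq ds ->
  pm w us ds = pm (fun d u => w u d) ds us.
Proof.
elim: us ds => [|u us IH] ds; first by rewrite pm_nil_r.
move=> /= /andP[uus uqus] uqds.
rewrite (@pm_expand_r _ _ _ _ _ u) //=; [|by rewrite uus|by rewrite inE eqxx].
by apply: eq_big_seq => d dds; rewrite eqxx IH ?rem_uniq.
Qed.

Lemma map_rem_inj (T1 T2 : eqType) (f : T1 -> T2) (s : seq T1) x : injective f ->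
  [seq f i | i <- rem x s] = rem (f x) [seq f i | i <- s].
Proof.
by move=> fi; elim: s => //= y s <-; rewrite (inj_eq fi); case: (y == x).
Qed.

Lemma pm_map (T1 T2 S1 S2 : eqType) (f : T1 -> T2) (g : S1 -> S2)
    (w : T2 -> S2 -> rat) us ds : injective g ->
  pm w [seq f u | u <- us] [seq g d | d <- ds] = pm (fun u d => w (f u) (g d)) us ds.
Proof.
move=> gi; elim: us ds => [|u us IH] ds /=; first by case: ds.
by rewrite big_map; apply: eq_bigr => d _; rewrite -map_rem_inj // IH.
Qed.

(** * Minors and elimination *)

Definition elts (m : nat) (X : {set 'I_m}) : seq nat := [seq val i | i <- enum X].

Lemma size_elts m (X : {set 'I_m}) : size (elts X) = #|X|.
Proof. by rewrite size_map -cardE. Qed.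

Lemma mem_elts m (X : {set 'I_m}) (i : 'I_m) : (val i \in elts X) = (i \in X).
Proof. by rewrite mem_map ?mem_enum //; exact: val_inj. Qed.

Lemma elts_lt m (X : {set 'I_m}) s : s \in elts X -> (s < m)%N.
Proof. by case/mapP => i _ ->; exact: ltn_ord. Qed.

Lemma sorted_elts m (X : {set 'I_m}) : sorted ltn (elts X).
Proof.
rewrite (subseq_sorted ltn_trans (_ : subseq _ (iota 0 m))) ?iota_ltn_sorted //.
by rewrite -val_enum_ord map_subseq // [enum 'I_m]enumT; apply: filter_subseq.
Qed.

Lemma uniq_elts m (X : {set 'I_m}) : uniq (elts X).
Proof. by rewrite map_inj_uniq ?enum_uniq //; exact: val_inj. Qed.

Lemma big_elts m (X : {set 'I_m}) (F : nat -> rat) K : #|X| = K ->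
  \prod_(i in X) F i = \prod_(j < K) F (nth 0%N (elts X) j).
Proof.
move=> <-; rewrite -size_elts -(big_mkord xpredT (fun j => F (nth 0%N (elts X) j))).
by rewrite -(big_nth _ xpredT) big_map big_enum_cond /=; apply: eq_bigl => i; rewrite andbT.
Qed.

Section Minor.

Variables (m K : nat).
Implicit Types (E : nat -> nat -> rat) (X : {set 'I_m}).

(** Stored transposed: row [j] of the matrix is column [nth 0 s j] of [E], so particles label the
    rows. *)
Definition minor_mx E (s : seq nat) : 'M[rat]_K := \matrix_(j, t) E t (nth 0%N s j).

Definition minor E X : rat := \det (minor_mx E (elts X)).

Lemma eq_minor E E' X : #|X| = K ->
  (forall t s, (t < K)%N -> (s < m)%N -> E t s = E' t s) -> minor E X = minor E' X.
Proof.
move=> cX e; congr (\det _); apply/matrixP => j t; rewrite !mxE e //.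
by apply: (@elts_lt _ X); rewrite mem_nth // size_elts cX.
Qed.

Lemma minor_scale E (c : nat -> rat) X : #|X| = K ->
  minor (fun t s => c s * E t s) X = (\prod_(i in X) c i) * minor E X.
Proof.
move=> cX; rewrite (big_elts c cX).
have <- : \det (diag_mx (\row_(j < K) c (nth 0%N (elts X) j))) =
          \prod_(j < K) c (nth 0%N (elts X) j).
  by rewrite det_diag; apply: eq_bigr => j _; rewrite mxE.
rewrite -det_mulmx mul_diag_mx; congr (\det _); apply/matrixP => j t.
by rewrite !mxE.
Qed.

Definition add_col (i : nat) E : nat -> nat -> rat :=
  fun t s => if s == i.+1 then E t i.+1 + E t i else E t s.

(** Multilinearity in the row of slot [j]: the extra determinant has [i] in place of [i.+1]. If [i]
    is in [X], two rows agree and it vanishes. Otherwise the list of slots stays sorted, nothing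
    lying between [i] and [i.+1], so it is the minor of the transposed set with sign +1. *)
Lemma minor_add_col E (i j : 'I_m) X : val j = i.+1 -> #|X| = K ->
  minor (add_col i E) X =
  minor E X + (if (i \notin X) && (j \in X) then minor E (tperm i j @: X) else 0).
Proof.
move=> ji cX; case jX : (j \in X); last first.
  rewrite andbF addr0; congr (\det _); apply/matrixP => r t; rewrite !mxE /add_col.
  case: eqP => // e; move: jX; rewrite -mem_elts ji -e mem_nth //.
  by rewrite size_elts cX.
have jidx : (index (val j) (elts X) < K)%N by rewrite -cX -size_elts index_mem mem_elts.
pose r0 := Ordinal jidx.
pose f (s : nat) : nat := if s == i.+1 then val i else s.
have nr0 : nth 0%N (elts X) r0 = i.+1 by rewrite -ji nth_index // mem_elts.
have nr (r : 'I_K) : r != r0 -> nth 0%N (elts X) r != i.+1.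
  apply: contra => /eqP e; apply/eqP/val_inj => /=; apply/eqP.
  rewrite -(nth_uniq 0%N _ _ (uniq_elts X)) ?size_elts ?cX //.
  by rewrite e nth_index ?mem_elts // ji.
have sz (r : 'I_K) : (r < size (elts X))%N by rewrite size_elts cX.
rewrite /minor (@determinant_multilinear _ _ _ (minor_mx E (elts X))
   (minor_mx E (map f (elts X))) r0 1 1).
- rewrite !mul1r; congr (_ + _); case: ifP => /=; rewrite ?andbT => iX.
    congr (\det (minor_mx _ _)); apply: (@irr_sorted_eq _ ltn ltn_trans ltnn).
    + apply: (@homo_sorted_in _ _ (mem (elts X)) f ltn) (sorted_elts X); last exact/allP.
      have iX' : (val i \in elts X) = false by rewrite mem_elts (negPf iX).
      move=> x y xX yX /= xy; rewrite /f.
      have : x != val i by apply: contraTneq xX => ->; apply/negP; rewrite iX'.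
      by rewrite /=; do 3 case: eqP => /= ?; lia.
    + exact: sorted_elts.
    have fE (k : 'I_m) : k \in X -> val (tperm i j k) = f (val k).
      move=> kX; rewrite permE /= /f -ji; case: eqP kX => [->|_ _]; first by rewrite (negPf iX).
      by rewrite (inj_eq val_inj); case: eqP.
    move=> x; apply/idP/idP.
      case/mapP => s /mapP[k]; rewrite mem_enum => kX -> ->.
      by rewrite -fE // mem_elts imset_f.
    case/mapP => k; rewrite mem_enum => /imsetP[k' k'X ->] ->.
    by rewrite fE // map_f // mem_elts.
  have iX' : i \in X by move/negbFE: iX.
  have iidx : (index (val i) (elts X) < K)%N by rewrite -cX -size_elts index_mem mem_elts.
  apply: (@determinant_alternate _ _ _ (Ordinal iidx) r0).
    apply/negP => /eqP/(congr1 val) /= e.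
    have := nth_index 0%N (_ : val i \in elts X); rewrite mem_elts e => /(_ iX').
    by rewrite nth_index ?mem_elts // ji /=; lia.
  move=> t; rewrite !mxE (nth_map 0%N) ?sz // (nth_map 0%N) ?sz // nr0 /f eqxx.
  rewrite nth_index ?mem_elts //; case: eqP => //; lia.
- apply/rowP => t; rewrite !mxE !mul1r /add_col (nth_map 0%N) ?sz // nr0 /f.
  by rewrite eqxx.
- apply/matrixP => r t; rewrite !mxE /add_col ifN // nr //.
  by rewrite eq_sym neq_lift.
- apply/matrixP => r t; rewrite !mxE /add_col (nth_map 0%N) ?sz // /f.
  by rewrite !(negPf (nr _ _)) // eq_sym neq_lift.
Qed.

End Minor.

Section Elimination.

Variables (T S : eqType) (w : T -> S -> rat) (m K : nat).
Implicit Types (E : nat -> nat -> rat) (X : {set 'I_m}) (sigma : nat -> S).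

Definition hit sigma X (d : S) : bool := [exists k in X, d == sigma (val k)].

(* The state of the sweep: the particles sit in the slots [X], i.e. the elements
   [sigma s], [s \in X], of [ds] are already matched. *)
Definition psum E sigma us ds : rat :=
  \sum_(X : {set 'I_m} | #|X| == K)
    minor K E X * pm w us [seq d <- ds | ~~ hit sigma X d].

(** The factor [g] hits column [i] only after its old value has been added to column [i.+1]: a
    particle that stays in its slot pays [g], one that moves on pays 1. *)
Definition elim_mx (i : nat) (g : rat) E : nat -> nat -> rat :=
  fun t s => (if s == i then g else 1) * add_col i E t s.

Definition upd (i : nat) (b : S) sigma : nat -> S :=
  fun s => if s == i then b else sigma s.

Lemma sum_support1 (l : seq S) (F : S -> rat) x : uniq l ->
  {in l, forall d, d != x -> F d = 0} ->
  \sum_(d <- l) F d = (if x \in l then F x else 0).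
Proof.
move=> uql F0; case: ifP => xl.
  rewrite (big_rem x) //= big_seq big1 ?addr0 // => d.
  by rewrite mem_rem_uniq // inE => /andP[dx dl]; rewrite F0.
by rewrite big_seq big1 // => d dl; rewrite F0 //; apply: contraFneq xl => <-.
Qed.

Lemma sum_support2 (l : seq S) (F : S -> rat) x y : uniq l -> x != y ->
  {in l, forall d, d != x -> d != y -> F d = 0} ->
  \sum_(d <- l) F d = (if x \in l then F x else 0) + (if y \in l then F y else 0).
Proof.
move=> uql xy F0; case: ifP => xl.
  rewrite (big_rem x) //= (@sum_support1 _ _ y) ?rem_uniq //.
    by rewrite mem_rem_uniq // inE eq_sym xy.
  by move=> d; rewrite mem_rem_uniq // inE => /andP[dx dl]; apply: F0.
rewrite add0r (@sum_support1 _ _ y) // => d dl; apply: F0 => //.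
by apply: contraFneq xl => <-.
Qed.

Lemma minor_elim E g (i : 'I_m) X : #|X| = K ->
  minor K (elim_mx i g E) X =
  (if i \in X then g else 1) * minor K (add_col i E) X.
Proof.
move=> cX; rewrite /elim_mx (minor_scale _ (fun s => if s == i :> nat then g else 1)) //.
congr (_ * _); case: ifP => iX.
  rewrite (bigD1 i) //= eqxx big1 ?mulr1 // => k /andP[_ ki].
  by rewrite ifN.
by rewrite big1 // => k kX; rewrite ifN //; apply: contraFneq iX => /val_inj <-.
Qed.

Lemma minor_add_last E (i : 'I_m) X : #|X| = K -> (i.+1 = m)%N ->
  minor K (add_col i E) X = minor K E X.
Proof.
move=> cX im; apply: eq_minor => // t s _; rewrite /add_col; case: eqP => //.
by move=> ->; rewrite im ltnn.
Qed.

Lemma hitP sigma X d : reflect (exists2 k, k \in X & d = sigma (val k)) (hit sigma X d).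
Proof. exact: (iffP 'exists_in_eqP). Qed.

Section Step.

Variables (sigma : nat -> S) (us : seq T) (ds : seq S) (u : T) (b : S) (i : 'I_m).
Hypotheses (uqu : uniq us) (uqd : uniq ds) (uus : u \in us) (dds : sigma i \in ds).
Hypothesis sigmaI : forall s s', (s < m)%N -> (s' < m)%N -> sigma s = sigma s' -> s = s'.
Hypothesis bN : forall s, (s < m)%N -> b != sigma s.
Hypothesis w0 : {in us, forall v, v != u -> w v (sigma i) = 0}.
Hypothesis w1 : w u (sigma i) = 1.
Hypothesis wnext : (i.+1 < m)%N -> sigma i.+1 \in ds /\ w u (sigma i.+1) = 1.
Hypothesis w2 : {in ds, forall d, d != sigma i -> d != b ->
  ((i.+1 < m)%N -> d != sigma i.+1) -> w u d = 0}.

Let g := if b \in ds then w u b else 0.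
Let Q X := pm w (rem u us) [seq d <- rem (sigma i) ds | ~~ hit (upd i b sigma) X d].

Let hit_upd X d : d \in ds -> d != b -> d != sigma i ->
  hit (upd i b sigma) X d = hit sigma X d.
Proof.
move=> dds' db di; apply/hitP/hitP => -[k kX dE]; exists k => //.
  by move: dE; rewrite /upd; case: eqP => // _ dE; rewrite dE eqxx in db.
by rewrite /upd; case: eqP => // e; rewrite dE e eqxx in di.
Qed.

Let hit_sigma X (k : 'I_m) : hit sigma X (sigma k) = (k \in X).
Proof.
apply/hitP/idP => [[k' k'X /sigmaI e]|kX]; last by exists k.
by rewrite (val_inj (e _ _)) ?ltn_ord.
Qed.

Let hit_b X : hit sigma X b = false.
Proof. by apply/hitP => -[k kX e]; move: (bN (ltn_ord k)); rewrite -e eqxx. Qed.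

Let hit_updb X : hit (upd i b sigma) X b = (i \in X).
Proof.
apply/hitP/idP => [[k kX]|iX]; last by exists i => //; rewrite /upd eqxx.
rewrite /upd; case: eqP => [/val_inj <- //|_ e].
by move: (bN (ltn_ord k)); rewrite -e eqxx.
Qed.

Lemma pm_notin X : i \notin X -> pm w us [seq d <- ds | ~~ hit sigma X d] = Q X.
Proof.
move=> iX; rewrite (@pm_forced _ _ _ _ _ u (sigma i)) ?filter_uniq //; last first.
  by rewrite mem_filter hit_sigma iX.
rewrite w1 mul1r; congr (pm _ _ _).
rewrite !rem_filter ?filter_uniq // -!filter_predI; apply: eq_in_filter => d dds'.
rewrite /= andbC; case: eqP => //= /eqP di; rewrite ?andbF ?andbT //=.
have [->|db] := eqVneq d b; first by rewrite hit_b hit_updb iX.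
by rewrite hit_upd.
Qed.

Lemma pm_in X : i \in X -> pm w us [seq d <- ds | ~~ hit sigma X d] =
  g * Q X + (if insub i.+1 is Some j then if j \in X then 0 else Q (tperm i j @: X) else 0).
Proof.
move=> iX.
have Qb : pm w (rem u us) (rem b [seq d <- ds | ~~ hit sigma X d]) = Q X.
  congr (pm _ _ _).
  rewrite !rem_filter ?filter_uniq // -!filter_predI; apply: eq_in_filter => d dds' /=.
  have [->|db] := eqVneq d b; first by rewrite hit_updb iX.
  have [->|di] := eqVneq d (sigma i); first by rewrite hit_sigma iX /= !andbF.
  by rewrite hit_upd // andbT.
rewrite (@pm_expand_l _ _ _ _ _ u) ?filter_uniq //.
have gQ : (if b \in [seq d <- ds | ~~ hit sigma X d] then w u b *
    pm w (rem u us) (rem b [seq d <- ds | ~~ hit sigma X d]) else 0) = g * Q X.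
  by rewrite mem_filter hit_b /= Qb /g; case: ifP; rewrite ?mul0r.
case: insubP => [j ltj ji|gej]; last first.
  rewrite (@sum_support1 _ _ b) ?filter_uniq ?addr0 // => d.
  rewrite mem_filter => /andP[dX dds'] db; rewrite w2 ?mul0r //.
    by apply: contraNneq dX => ->; rewrite hit_sigma.
  by rewrite (negPf gej).
have jE : sigma j = sigma i.+1 by rewrite -ji.
have [jds wj] := wnext ltj.
rewrite (@sum_support2 _ _ b (sigma j)) ?filter_uniq //; last 2 first.
- exact: bN.
- move=> d; rewrite mem_filter => /andP[dX dds'] db dj; rewrite w2 ?mul0r //.
    by apply: contraNneq dX => ->; rewrite hit_sigma.
  by rewrite -jE.
congr (_ + _) => //; rewrite mem_filter hit_sigma jE jds wj andbT mul1r if_neg.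
case: ifP => // jX; congr (pm _ _ _).
rewrite !rem_filter ?filter_uniq // -!filter_predI; apply: eq_in_filter => d dds' /=.
have ij : i != j by apply: contraFneq jX => <-.
have jN : j \in tperm i j @: X by rewrite -[Y in Y \in _](tpermL i j) imset_f.
have iN : i \in tperm i j @: X = false.
  by rewrite -[Y in Y \in _](tpermR i j) mem_imset ?jX //; exact: perm_inj.
have [->|db] := eqVneq d b; first by rewrite hit_updb hit_b iN -jE !bN.
have [->|di] := eqVneq d (sigma i); first by rewrite hit_sigma iX /= !andbF.
rewrite hit_upd // andbT; have [->|dj] := eqVneq d (sigma i.+1).
  by rewrite -jE !hit_sigma jN.
have tD (k : 'I_m) : d = sigma k -> (k \in tperm i j @: X) = (k \in X).
  move=> dE; rewrite -{1}[k](tpermK i j) mem_imset; last exact: perm_inj.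
  rewrite tpermD //; apply/eqP => e; first by rewrite dE -e eqxx in di.
  by rewrite dE -e jE eqxx in dj.
by congr (~~ _); apply/hitP/hitP => -[k kX dE]; exists k => //; rewrite tD in kX *.
Qed.

(* [sigma i] can only be matched with [u].  If it is free, both disappear; if it
   is taken, [u] goes to [sigma i.+1] or to [b], that is, the particle of slot [i]
   moves to slot [i.+1] or stays in slot [i], now standing for [b].  Column [i]
   being added to column [i.+1], the states with particles in both slots cause no
   correction, since the corresponding minor is alternating. *)
Lemma psum_step E : psum E sigma us ds =
  psum (elim_mx i g E) (upd i b sigma) (rem u us) (rem (sigma i) ds).
Proof.
rewrite /psum [LHS](eq_bigr (fun X => minor K E X *
   (if i \in X then g * Q X + (if insub i.+1 is Some j then
     if j \in X then 0 else Q (tperm i j @: X) else 0) else Q X))); last first.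
  by move=> X _; case: ifPn => [/pm_in|/pm_notin] ->.
rewrite [RHS](eq_bigr (fun X => (if i \in X then g else 1) *
    minor K (add_col i E) X * Q X)); last first.
  by move=> X /eqP cX; rewrite minor_elim.
case: insubP => [j ltj ji|gej]; last first.
  apply: eq_bigr => X /eqP cX; rewrite minor_add_last //; last first.
    by apply/eqP; rewrite eqn_leq ltn_ord leqNgt.
  by case: ifP; rewrite ?addr0 ?mul1r // => _; rewrite mulrCA mulrA.
under [RHS]eq_bigr => X /eqP cX.
  rewrite (minor_add_col _ ji cX) mulrDr mulrDl.
  over.
rewrite big_split /=.
transitivity (\sum_(X : {set 'I_m} | #|X| == K)
   ((if i \in X then g else 1) * minor K E X * Q X +
    (if (i \in X) && (j \notin X) then minor K E X * Q (tperm i j @: X) else 0))).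
  apply: eq_bigr => X _; case: ifP => _ /=; last by rewrite addr0 mul1r.
  by rewrite mulrDr mulrCA mulrA; case: ifP; rewrite ?mulr0 ?addr0.
rewrite big_split /=; congr (_ + _).
(* The moves from [i] to [j] are indexed by the state before the move, the corrections of
   [minor_add_col] by the state after it; the transposition converts one into the other. *)
have tK : involutive (fun X : {set 'I_m} => tperm i j @: X).
  move=> X; rewrite -imset_comp (eq_imset _ (g := id)) ?imset_id //.
  by move=> k /=; rewrite tpermK.
rewrite (reindex_inj (inv_inj tK)) /=; apply: eq_big => X.
  by rewrite card_imset //; exact: perm_inj.
rewrite tK.
rewrite -[Y in (Y \in _) && _](tpermR i j) -[Y in _ && (Y \notin _)](tpermL i j).
rewrite !mem_imset; try exact: perm_inj.
by move=> _; case: (boolP (i \in X)) => iX; case: (boolP (j \in X)) => jX /=;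
  rewrite ?mulr0 ?mul0r // mul1r.
Qed.

End Step.
End Elimination.

Lemma eq_psum (T S : eqType) (w : T -> S -> rat) m K E E' sigma sigma' us ds :
  (forall t s, (t < K)%N -> (s < m)%N -> E t s = E' t s) ->
  (forall s, (s < m)%N -> sigma s = sigma' s) ->
  psum w m K E sigma us ds = psum w m K E' sigma' us ds.
Proof.
move=> eE es; apply: eq_bigr => X /eqP cX; rewrite (eq_minor cX eE).
congr (_ * pm _ _ _); apply: eq_filter => d; congr (~~ _).
by apply/hitP/hitP => -[k kX ->]; exists k; rewrite ?es ?ltn_ord.
Qed.

(* The first slot of row [r].  Each even row, being one down triangle short, is
   completed at its west end by a virtual down triangle, which is matched from the
   start: the [K] virtual triangles carry the initial particles, the one of row
   [2 t] in slot [K - 1 - t]. *)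
Definition row_start (K r : nat) : nat := (K - (r./2).+1)%N.

(** The composite of the operations [elim_mx] along a row: each column is added to the next after
    having received its predecessors, so the columns turn into partial sums. *)
Definition row_mx (K : nat) (c : nat -> rat) (r : nat) (E : nat -> nat -> rat) :=
  fun t s => if (s < row_start K r)%N then E t s
             else c s * \sum_(row_start K r <= s' < s.+1) E t s'.

Fixpoint rows_mx (K : nat) (cw : nat -> nat -> rat) (r : nat) : nat -> nat -> rat :=
  if r is r'.+1 then row_mx K (cw r') r' (rows_mx K cw r')
  else fun t s => (s == t)%:R.

(** * The sweep through an abstract half *)

Section RowLists.

Variables (m K a : nat).

Notation z := (row_start K).

Definition row_from (R : Type) (l : nat -> nat -> R) (r i : nat) : seq R :=
  [seq l r s | s <- iota i (m - i)].

Definition rows_from (R : Type) (l : nat -> nat -> R) (r : nat) : seq R :=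
  flatten [seq row_from l r' (z r') | r' <- iota r (a - r)].

Lemma mem_row_from (R : eqType) (l : nat -> nat -> R) r i x :
  reflect (exists2 s, (i <= s < m)%N & x = l r s) (x \in row_from l r i).
Proof.
apply: (iffP mapP) => -[s sP ->]; exists s => //; move: sP; rewrite mem_iota; lia.
Qed.

Lemma mem_rows_from (R : eqType) (l : nat -> nat -> R) r x :
  reflect (exists2 p : nat * nat, (r <= p.1 < a)%N && (z p.1 <= p.2 < m)%N & x = l p.1 p.2)
    (x \in rows_from l r).
Proof.
apply: (iffP flatten_mapP) => [[r' r'P /mem_row_from[s sP ->]]|[[r' s] /andP[/= rP sP] ->]].
  by exists (r', s) => //=; move: r'P; rewrite sP mem_iota; lia.
exists r'; first by rewrite mem_iota; lia.
by apply/mem_row_from; exists s.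
Qed.

Lemma rows_from_S (R : Type) (l : nat -> nat -> R) r : (r < a)%N ->
  rows_from l r = row_from l r (z r) ++ rows_from l r.+1.
Proof. by move=> ra; rewrite /rows_from -(subnSK ra). Qed.

Lemma row_from_S (R : Type) (l : nat -> nat -> R) r i : (i < m)%N ->
  row_from l r i = l r i :: row_from l r i.+1.
Proof. by move=> im; rewrite /row_from -(subnSK im). Qed.

Lemma rows_from_suffix (R : eqType) (l : nat -> nat -> R) r (s : seq R) : (r <= a)%N ->
  uniq (rows_from l 0 ++ s) -> uniq (rows_from l r ++ s).
Proof.
elim: r => // r IH ra /(IH (ltnW ra)); rewrite rows_from_S // -catA.
by rewrite cat_uniq => /and3P[].
Qed.

Lemma row_from_suffix (R : eqType) (l : nat -> nat -> R) r i (s : seq R) :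
  (r < a)%N -> (z r <= i < m)%N ->
  uniq (rows_from l 0 ++ s) -> uniq (row_from l r i ++ rows_from l r.+1 ++ s).
Proof.
move=> ra /andP[zi im] /(rows_from_suffix (ltnW ra)); rewrite rows_from_S // -catA.
rewrite /row_from (_ : (m - z r = (i - z r) + (m - i))%N); last lia.
rewrite iotaD map_cat subnKC // -catA [uniq (map _ _ ++ _)]cat_uniq.
by case/and3P.
Qed.

Lemma uniq_rows_from (R : eqType) (l : nat -> nat -> R) (s : seq R) :
  (forall r r' i i', (r < a)%N -> (r' < a)%N -> (i < m)%N -> (i' < m)%N ->
     l r i = l r' i' -> r = r' /\ i = i') ->
  (forall r i, (r < a)%N -> (i < m)%N -> l r i \notin s) -> uniq s ->
  uniq (rows_from l 0 ++ s).
Proof.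
move=> lI ls uqs.
have H r : (r <= a)%N -> uniq (rows_from l (a - r) ++ s).
  elim: r => [|r IH] ra; first by rewrite subn0 /rows_from subnn.
  rewrite rows_from_S; last lia.
  have -> : (a - r.+1).+1 = (a - r)%N by lia.
  rewrite -catA cat_uniq IH ?(ltnW ra) // andbT.
  apply/andP; split.
    rewrite map_inj_in_uniq ?iota_uniq // => i j; rewrite !mem_iota => ii jj e.
    by apply: (proj2 (lI _ _ _ _ _ _ _ _ e)); lia.
  apply/hasPn => x; rewrite mem_cat => /orP[/mem_rows_from[p /andP[p1 p2] ->]|xs].
    apply/negP => /mem_row_from[i ii] e.
    have : p.1 = (a - r.+1)%N by apply: (proj1 (lI _ _ _ _ _ _ _ _ e)); lia.
    by lia.
  by apply/negP => /mem_row_from[i ii] e; move: (ls (a - r.+1)%N i); rewrite -e xs; lia.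
by rewrite -(subnn a) H.
Qed.

End RowLists.

Section Rows.

Variables (T S : eqType) (w : T -> S -> rat) (m K a : nat).
Variables (ul : nat -> nat -> T) (dl : nat -> nat -> S) (us0 : seq T) (ds0 : seq S).
Variables (c : nat -> nat -> rat) (cf : nat -> rat).

Notation z := (row_start K).
Notation row_from := (row_from m).
Notation rows_from := (rows_from m K a).

Hypothesis Ka : uphalf a = K.
Hypothesis uqu : uniq (rows_from ul 0 ++ us0).
Hypothesis uqd : uniq (rows_from dl 0 ++ ds0).
Hypothesis dlI : forall r r' s s', (r <= a)%N -> (r' <= a)%N -> (s < m)%N -> (s' < m)%N ->
  dl r s = dl r' s' -> r = r' /\ s = s'.
Hypothesis wE : forall r i r' s, (r < a)%N -> (z r <= i < m)%N ->
  (r' < a)%N -> (z r' <= s < m)%N ->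
  w (ul r i) (dl r' s) =
    if r' == r then ((s == i) || (s == i.+1))%:R
    else if (r' == r.+1) && (s == i) then c r i else 0.
Hypothesis w_us0 : forall u r s, u \in us0 -> (r < a)%N -> (z r <= s < m)%N ->
  w u (dl r s) = 0.
Hypothesis w_ds0 : forall r i d, (r < a)%N -> (z r <= i < m)%N -> d \in ds0 ->
  w (ul r i) d = if (r.+1 == a) && (d == dl a i) then cf i else 0.

(** Below the last row the next triangle may be missing from [ds0]; this is encoded by the weight
    0. *)
Definition cell_weight (r i : nat) : rat :=
  if (r.+1 < a)%N then c r i else if dl a i \in ds0 then cf i else 0.

(** Slots before [z r] hold virtual triangles of later rows, not yet reached by the sweep; slots
    from [z r] up to [i] have already passed to row [r.+1]; the others are still in row [r]. *)
Definition frontier (r i s : nat) : S :=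
  if (s < z r)%N then dl (K.-1 - s).*2 s else if (s < i)%N then dl r.+1 s else dl r s.

(** The state when the sweep is about to treat cell [i]: earlier columns are final, column [i] has
    received its partial sum but not yet its weight, later columns are unchanged. *)
Definition row_mx_at (r i : nat) (E : nat -> nat -> rat) : nat -> nat -> rat :=
  fun t s => if (s < z r)%N then E t s
    else if (s < i)%N then cell_weight r s * \sum_(z r <= s' < s.+1) E t s'
    else if s == i then \sum_(z r <= s' < s.+1) E t s' else E t s.

Lemma row_start_S r : (z r.+1 <= z r)%N.
Proof. rewrite /row_start; lia. Qed.

Lemma psum_cell E r i : (r < a)%N -> (z r <= i < m)%N ->
  psum w m K (row_mx_at r i E) (frontier r i)
    (row_from ul r i ++ rows_from ul r.+1 ++ us0)
    (row_from dl r i ++ rows_from dl r.+1 ++ ds0) =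
  psum w m K (row_mx_at r i.+1 E) (frontier r i.+1)
    (row_from ul r i.+1 ++ rows_from ul r.+1 ++ us0)
    (row_from dl r i.+1 ++ rows_from dl r.+1 ++ ds0).
Proof.
move=> ra zim; have [zi im] := andP zim.
have uqu' := row_from_suffix ra zim uqu; have uqd' := row_from_suffix ra zim uqd.
have zS := row_start_S r.
have fi : frontier r i i = dl r i by rewrite /frontier ltnNge zi ltnn.
have fi1 : frontier r i i.+1 = dl r i.+1 by rewrite /frontier !ltnNge (leqW zi) leqnSn.
have memd d : d \in row_from dl r i ++ rows_from dl r.+1 ++ ds0 ->
    (exists p : nat * nat, [/\ (p.1 < a)%N, (z p.1 <= p.2 < m)%N & d = dl p.1 p.2]) \/ d \in ds0.
  rewrite !mem_cat => /or3P[/mem_row_from[s sP ->]|/mem_rows_from[p /andP[/andP[_ pa] pm] ->]|->].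
  - by left; exists (r, s); split => //=; lia.
  - by left; exists p.
  - by right.
rewrite (@psum_step _ _ _ _ _ (frontier r i) _ _ (ul r i) (dl r.+1 i) (Ordinal im)) //=.
- rewrite fi !(row_from_S _ _ im) /= !eqxx.
  apply: eq_psum => [t s tK sm|s sm]; last first.
    rewrite /upd /frontier; have [->|si] := eqVneq s i; first by rewrite ltnNge zi ltnSn.
    by rewrite ltnS (leq_eqVlt s i) (negPf si).
  have -> : (if dl r.+1 i \in dl r i :: row_from dl r i.+1 ++ rows_from dl r.+1 ++ ds0
       then w (ul r i) (dl r.+1 i) else 0) = cell_weight r i.
    rewrite /cell_weight; case: ltnP => ra'.
      rewrite wE //; [|lia]; rewrite ifT ?(gtn_eqF (ltnSn r)) ?eqxx //.
      rewrite !inE !mem_cat; apply/or4P; apply: Or43.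
      by apply/mem_rows_from; exists (r.+1, i) => //=; lia.
    have ea : r.+1 = a by lia.
    have da : dl a i = dl r.+1 i by rewrite ea.
    rewrite da; case: (boolP (dl r.+1 i \in ds0)) => dP.
      by rewrite !inE !mem_cat dP !orbT w_ds0 // da ea !eqxx.
    (* If [dl a i] is not in [ds0], it cannot be a remaining triangle of rows [r] and later either,
       since these all lie above row [a]. *)
    case: ifP => //; rewrite -cat_cons -(row_from_S _ _ im) => /memd[[p [pa pm /dlI e]]|].
      by case: e; lia.
    by rewrite (negPf dP).
  rewrite /elim_mx /add_col /row_mx_at.
  have [->|si] := eqVneq s i.
    by rewrite (ltn_eqF (ltnSn i)) ltnNge zi /= ltnn ?eqxx ltnSn.
  rewrite mul1r; have [->|si1] := eqVneq s i.+1.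
    have h1 : (i.+1 < z r)%N = false by lia.
    have h2 : (i < z r)%N = false by lia.
    have h3 : (i.+1 < i)%N = false by lia.
    have h4 : (i.+1 == i) = false by lia.
    by rewrite h1 h2 h3 h4 !ltnn !eqxx [RHS]big_nat_recr ?leqW //= addrC.
  by case: ltnP => // zs; rewrite ltnS (leq_eqVlt s i) (negPf si).
- by rewrite row_from_S // inE eqxx.
- by rewrite fi row_from_S // inE eqxx.
- move=> s s' sm s'm.
  have fE x : (x < m)%N -> exists2 y, (y <= a)%N & frontier r i x = dl y x.
    rewrite /frontier => xm; case: ltnP => xz.
      by exists (K.-1 - x).*2 => //; move: xz; rewrite /row_start; lia.
    by case: ltnP => _; [exists r.+1|exists r] => //; exact: ltnW.
  have [y ya ->] := fE s sm; have [y' y'a ->] := fE s' s'm.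
  by case/dlI.
- move=> s sm; rewrite /frontier; apply/eqP.
  case: ltnP => sz; first by case/dlI => //; try lia; move: sz; rewrite /row_start; lia.
  by case: ltnP => si; case/dlI => //; lia.
- move=> v; rewrite fi row_from_S // inE => /orP[/eqP-> /eqP //|].
  rewrite !mem_cat => /or3P[/mem_row_from[s sP ->] _|/mem_rows_from[p /andP[p1 p2] ->] _|v0 _].
  + rewrite wE ?eqxx //; [|lia]; rewrite (_ : (_ || _) = false) //; lia.
  + by rewrite wE ?ifN //; lia.
  + by rewrite w_us0.
- by rewrite fi wE // !eqxx.
- move=> im1; rewrite fi1 row_from_S // row_from_S // !inE eqxx orbT; split => //.
  by rewrite wE ?eqxx ?orbT //; lia.
- move=> d; rewrite fi => /memd[[[r' s] /= [r'a sm ->]]|dds].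
  + move=> d1 d2 d3; rewrite wE //.
    case: eqP => [er|_].
      subst r'; case: eqP => [es|_ /=]; first by rewrite es eqxx in d1.
      case: eqP => // es; move: d3; rewrite fi1 es eqxx => d3.
      by have := d3 ltac:(lia).
    by case: andP => // -[/eqP er /eqP es]; rewrite er es eqxx in d2.
  + move=> _ d2 _; rewrite w_ds0 //; case: andP => // -[/eqP er /eqP ed].
    by rewrite ed er eqxx in d2.
Qed.

Lemma psum_row E r : (r < a)%N -> (z r <= m)%N ->
  psum w m K E (frontier r (z r)) (rows_from ul r ++ us0) (rows_from dl r ++ ds0) =
  psum w m K (row_mx K (cell_weight r) r E) (frontier r.+1 (z r.+1))
    (rows_from ul r.+1 ++ us0) (rows_from dl r.+1 ++ ds0).
Proof.
move=> ra zm.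
transitivity (psum w m K (row_mx_at r m E) (frontier r m)
    (row_from ul r m ++ rows_from ul r.+1 ++ us0)
    (row_from dl r m ++ rows_from dl r.+1 ++ ds0)); last first.
  rewrite /row_from subnn /=; apply: eq_psum => [t s tK sm|s sm].
    by rewrite /row_mx_at /row_mx sm.
  rewrite /frontier sm; case: (ltnP s (z r.+1)) => s1; case: ltnP => s2 //.
  - by move: (row_start_S r); lia.
  - by congr (dl _ _); move: s1 s2; rewrite /row_start; lia.
have H k : (z r + k <= m)%N ->
   psum w m K E (frontier r (z r)) (rows_from ul r ++ us0) (rows_from dl r ++ ds0) =
   psum w m K (row_mx_at r (z r + k) E) (frontier r (z r + k))
    (row_from ul r (z r + k) ++ rows_from ul r.+1 ++ us0)
    (row_from dl r (z r + k) ++ rows_from dl r.+1 ++ ds0).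
  elim: k => [|k IH] km; last by rewrite addnS -psum_cell -?IH //; lia.
  rewrite addn0 !(rows_from_S _ _ _ ra) -!catA; apply: eq_psum => // t s _ _.
  rewrite /row_mx_at; case: ltnP => // zs.
  by case: eqP => // ->; rewrite big_nat1.
by rewrite (H (m - z r)%N) subnKC.
Qed.

Hypothesis Km : (K <= m)%N.

Lemma psum_rows r : (r <= a)%N ->
  psum w m K (rows_mx K cell_weight 0) (frontier 0 (z 0)) (rows_from ul 0 ++ us0) (rows_from dl 0 ++ ds0) =
  psum w m K (rows_mx K cell_weight r) (frontier r (z r)) (rows_from ul r ++ us0) (rows_from dl r ++ ds0).
Proof.
elim: r => // r IH ra; rewrite IH ?(ltnW ra) // psum_row //.
by rewrite /row_start; lia.
Qed.

Lemma card_lt_set : #|[set i : 'I_m | (i < K)%N]| = K.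
Proof.
rewrite cardsE -sum1_card (eq_bigl (fun i : 'I_m => (i < K)%N)) //.
by rewrite (big_ord_narrow Km) sum1_card card_ord.
Qed.

(** A set of [K] slots other than the first [K] contains some slot beyond them, and the identity
    matrix has a zero row there. So the sweep starts in a single state. *)
Lemma minor_id (X : {set 'I_m}) : #|X| = K ->
  minor K (fun t s => (s == t)%:R) X = (X == [set i : 'I_m | (i < K)%N])%:R.
Proof.
move=> cX; have cI := card_lt_set.
case: eqP => [->|nX].
  rewrite /minor (_ : minor_mx _ _ _ = 1%:M) ?det1 //.
  apply/matrixP => j t; rewrite !mxE.
  suff -> : elts [set i : 'I_m | (i < K)%N] = iota 0 K by rewrite nth_iota.
  apply: (@irr_sorted_eq _ ltn ltn_trans ltnn); rewrite ?sorted_elts ?iota_ltn_sorted //.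
  move=> s; rewrite mem_iota /=; apply/mapP/idP => [[i]|sK].
    by rewrite mem_enum inE => iK ->.
  by exists (Ordinal (leq_trans sK Km)); rewrite // mem_enum inE.
have [/existsP[i /andP[iX Ki]]|/existsPn sub] := boolP [exists i, (i \in X) && (K <= i)%N].
  have jK : (index (val i) (elts X) < K)%N by rewrite -cX -size_elts index_mem mem_elts.
  rewrite /minor (expand_det_row _ (Ordinal jK)) big1 // => t _.
  rewrite mxE /= nth_index ?mem_elts // [_ == _](_ : _ = false) ?mul0r //.
  by apply/negbTE; rewrite neq_ltn (leq_trans (ltn_ord t) Ki) orbT.
case: nX; apply/eqP; rewrite eqEcard cX cI leqnn andbT; apply/subsetP => i iX.
by move: (sub i); rewrite inE iX /= -ltnNge.
Qed.

(** The list [rows_from dl 0] contains the virtual triangles and [ds] does not; the starting state,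
    the first [K] slots, declares exactly these as matched. *)
Lemma pm_rows us ds : uniq us -> uniq ds ->
  us =i rows_from ul 0 ++ us0 ->
  ds =i [seq d <- rows_from dl 0 ++ ds0 |
          ~~ hit (fun s => dl (K.-1 - s).*2 s) [set i : 'I_m | (i < K)%N] d] ->
  pm w us ds = \sum_(X : {set 'I_m} | #|X| == K)
    minor K (rows_mx K cell_weight a) X * pm w us0 [seq d <- ds0 | ~~ hit (dl a) X d].
Proof.
move=> uqus uqds eu ed.
transitivity (psum w m K (rows_mx K cell_weight a) (frontier a (z a)) (rows_from ul a ++ us0)
   (rows_from dl a ++ ds0)); last first.
  rewrite /rows_from subnn /=; apply: eq_psum => // s _; rewrite /frontier.
  by rewrite /row_start (_ : (K - _ = 0)%N) //; lia.
rewrite -psum_rows // /psum (bigD1 [set i : 'I_m | (i < K)%N]) /= ?card_lt_set //.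
rewrite [X in _ + X]big1 ?addr0 => [|X /andP[/eqP cX nX]]; last first.
  by rewrite minor_id // (negPf nX) mul0r.
rewrite minor_id ?card_lt_set // eqxx mul1r.
rewrite (@pm_perm_l _ _ _ us (rows_from ul 0 ++ us0)) ?uniq_perm //.
apply: pm_perm_r; apply: uniq_perm; rewrite ?filter_uniq // => d.
rewrite ed; congr (_ \in _); apply: eq_filter => x; congr (~~ _).
have fE (k : 'I_m) : (k < K)%N -> dl (K.-1 - k).*2 k = frontier 0 (z 0) k.
  move=> kK; rewrite /frontier; case: ltnP => // zk.
  by congr (dl _ _); move: zk; rewrite /row_start; lia.
by apply/hitP/hitP => -[k kX ->]; exists k => //; rewrite fE //; move: kX; rewrite inE.
Qed.

End Rows.

(** * Evaluation of the minors *)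

(** [node true z] is the square of z + 1/2 less 1/4. With segment number s = z + 1, differences of
    nodes give (s' - s)(s + s' - 1) for [e = true] and (s' - s)(s + s' - 2) for [e = false], the
    factors for W and Wbar. *)
Definition node (e : bool) (z : nat) : rat :=
  if e then z%:R ^+ 2 + z%:R else z%:R ^+ 2.

Definition newton (e : bool) (j z : nat) : rat := \prod_(i < j) (node e z - node e i).

(* [beta] and [alpha] are the iterated sums of the constant 1 (see [sum_alpha] and
   [sum_beta]); as functions of the segment number [z + 1] they are polynomials
   which are even about 1, resp. odd about 1/2, thanks to the weight 1/2. *)
Definition beta (j z : nat) : rat := newton false j z / ((2 * j)`!)%:R.
Definition alpha (j z : nat) : rat :=
  (2 * z%:R + 1) * newton true j z / (2 * ((2 * j).+1`!)%:R).

Lemma newtonS e j z : newton e j.+1 z = newton e j z * (node e z - node e j).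
Proof. by rewrite /newton big_ord_recr. Qed.

Lemma newton00 e j : newton e j.+1 0 = 0.
Proof. by rewrite /newton big_ord_recl /= subrr mul0r. Qed.

(** Here and in the next three lemmas both sides are products of the same linear factors up to end
    terms: [node true z - node true i] is (z - i)(z + i + 1), and [node false z - node false i] is
    (z - i)(z + i). *)
Lemma newton_shift_even j n :
  newton false j.+1 n.+1 = (n%:R + 1) * (n%:R + 1 + j%:R) * newton true j n.
Proof.
elim: j => [|j IH]; first by rewrite newtonS /newton !big_ord0 /node -natr1; ring.
by rewrite newtonS IH newtonS /node -!natr1; ring.
Qed.

Lemma newton_even j n : newton false j.+1 n = n%:R * (n%:R - j%:R) * newton true j n.
Proof.
elim: j => [|j IH]; first by rewrite newtonS /newton !big_ord0 /node; ring.
by rewrite newtonS IH newtonS /node -!natr1; ring.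
Qed.

Lemma newton_shift_odd j n :
  (n%:R + 1) * newton true j n.+1 = (n%:R + 1 + j%:R) * newton false j n.+1.
Proof.
elim: j => [|j IH]; first by rewrite /newton !big_ord0; ring.
by rewrite !newtonS mulrA IH /node -!natr1; ring.
Qed.

Lemma newton_odd j n :
  (n%:R + 1) * newton true j n = (n%:R + 1 - j%:R) * newton false j n.+1.
Proof.
elim: j => [|j IH]; first by rewrite /newton !big_ord0; ring.
by rewrite !newtonS mulrA IH /node -!natr1; ring.
Qed.

Lemma factR_neq0 k : (k`!)%:R != 0 :> rat.
Proof. by rewrite pnatr_eq0 -lt0n fact_gt0. Qed.

Lemma betaS j n : beta j.+1 n.+1 = beta j.+1 n + alpha j n.
Proof.
have f0 := factR_neq0 (2 * j).
have j0 : 0 <= j%:R :> rat by [].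
have e1 : ((2 * j).+1`!)%:R = (2 * j%:R + 1) * (2 * j)`!%:R :> rat.
  by rewrite factS natrM -natr1 natrM.
have e2 : ((2 * j.+1)`!)%:R = (2 * j%:R + 2) * ((2 * j%:R + 1) * (2 * j)`!%:R) :> rat.
  rewrite mulnS addSn add1n factS natrM e1; congr (_ * _).
  by rewrite -!natr1 natrM; ring.
rewrite /beta /alpha newton_shift_even newton_even e1 e2.
by field; rewrite f0; apply/andP; split; lra.
Qed.

Lemma sum_alpha j n : \sum_(0 <= z < n) alpha j z = beta j.+1 n.
Proof.
elim: n => [|n IH]; first by rewrite big_geq // /beta newton00 mul0r.
by rewrite big_nat_recr //= IH betaS.
Qed.

Lemma alphaS j n : alpha j n.+1 = alpha j n + beta j n.+1.
Proof.
rewrite /beta /alpha.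
have n0 : n%:R + 1 != 0 :> rat by rewrite natr1 pnatr_eq0.
(* The comparisons [newton_shift_odd] and [newton_odd] are available only after multiplication by n
   + 1. *)
apply: (mulfI n0); rewrite mulrDr.
have -> x : (n%:R + 1) * (x * newton true j n.+1 / (2 * (2 * j).+1`!%:R)) =
   x * ((n%:R + 1) * newton true j n.+1) / (2 * (2 * j).+1`!%:R) by ring.
have -> x : (n%:R + 1) * (x * newton true j n / (2 * (2 * j).+1`!%:R)) =
   x * ((n%:R + 1) * newton true j n) / (2 * (2 * j).+1`!%:R) by ring.
rewrite newton_shift_odd newton_odd factS natrM -!natr1 natrM.
have := factR_neq0 (2 * j); set f := (_`!)%:R => f0.
have j0 : 0 <= j%:R :> rat by [].
by field; rewrite f0 /=; lra.
Qed.

(** The recurrence [alphaS], read at -1, says that alpha(0) - alpha(-1) = beta(0); as alpha is odd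
    about -1/2, alpha(0) is half of beta(0). This is the source of the weight 1/2. *)
Lemma sum_beta j n :
  \sum_(0 <= z < n.+1) (if z == 0%N then 2^-1 else 1) * beta j z = alpha j n.
Proof.
elim: n => [|n IH]; last by rewrite big_nat_recr //= IH alphaS mul1r.
rewrite big_nat1 /= /alpha /beta; case: j => [|j]; last by rewrite !newton00 !(mulr0, mul0r).
by rewrite /newton !big_ord0.
Qed.

Section RowsFormula.

Variables (K a : nat) (cw : nat -> nat -> rat).
Hypothesis Ka : uphalf a = K.
Hypothesis cwE : forall r s, (r.+1 < a)%N ->
  cw r s = if ~~ odd r && (s == row_start K r) then 2^-1 else 1.

Definition basis (r j z : nat) : rat := if odd r then beta j z else alpha j z.

Let line_start r := (K - uphalf r)%N.

Lemma sum_shift (F : nat -> rat) o s : (o <= s)%N ->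
  \sum_(o <= s' < s.+1) F s' = \sum_(0 <= z < (s - o).+1) F (z + o)%N.
Proof. by move=> os; rewrite -{1}(add0n o) big_addn subSn. Qed.

(** The virtual triangle of slot [t] enters when [line_start r] has dropped to [t]. From then on row
    [t] of the matrix is a basis function of the distance from the west end, and its index grows by
    one with each further virtual triangle. *)
Let row_value r t s : rat :=
  if (s < line_start r)%N then (s == t)%:R
  else if (t < line_start r)%N then 0
  else basis r (t - line_start r) (s - line_start r).

(** An odd row brings no new slot: it sums [beta], with the factor 1/2 left at the west end by the
    preceding row, into [alpha]. An even row starts one slot further west, at a virtual triangle,
    and sums [alpha] into the next [beta]. The factor 1/2 in the hypothesis is that of the preceding
    row. *)
Lemma row_mxE r E t s : (r < a)%N -> (t < K)%N ->
  (forall s, E t s =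
     (if odd r && (s == line_start r) then 2^-1 else 1) * row_value r t s) ->
  row_mx K (cw r) r E t s =
  (if (s < line_start r.+1)%N then 1 else cw r s) * row_value r.+1 t s.
Proof.
move=> ra tK EE; rewrite /row_mx.
have rs : row_start K r = line_start r.+1 by rewrite /row_start /line_start; lia.
rewrite rs /row_value; case: ltnP => so.
  have h : (s < line_start r)%N by move: so; rewrite /line_start; lia.
  by rewrite mul1r EE /row_value h (ltn_eqF h) andbF mul1r.
congr (_ * _).
have [ro|re] := boolP (odd r).
  have lr : line_start r = line_start r.+1 by rewrite /line_start; lia.
  rewrite sum_shift // -lr; case: ltnP => tl.
    rewrite big1 // => z _; rewrite EE /row_value ltnNge leq_addl /= tl mulr0 //.
  rewrite /basis /= ro /= -sum_beta; apply: eq_bigr => z _.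
  rewrite EE /row_value ltnNge leq_addl /= ltnNge tl /= ro /basis ro addnK.
  by rewrite -[X in _ == X](add0n (line_start r)) eqn_add2r.
have lr : line_start r = (line_start r.+1).+1 by rewrite /line_start; lia.
rewrite (eq_bigr (row_value r t)); last by move=> z _; rewrite EE (negPf re) mul1r.
rewrite big_nat_recl //= {1}/row_value lr ltnSn.
(* According to the position of [t] relative to the new slot: not entered yet, hence 0; entered
   before, hence [sum_alpha]; entering now, where the sum of a single unit entry is the constant
   [beta 0]. *)
have [lt|gt|eqt] := ltngtP t (line_start r.+1).
- rewrite ?(gtn_eqF lt) add0r big_nat big1 // => z zz.
  by rewrite /row_value lr ltnS ltnNge (_ : _ <= _)%N //= ?ltnS ?(ltnW lt) //; lia.
- rewrite ?(ltn_eqF gt) add0r /basis /= re -[(t - _)%N]prednK ?subn_gt0 // -sum_alpha.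
  rewrite -{1}(add0n (line_start r.+1)) big_addn; apply: eq_bigr => z _.
  rewrite /row_value lr ltnS ltnNge leq_addl /= ltnS (leqNgt t) gt /= /basis (negPf re).
  by congr (alpha _ _); lia.
- rewrite ?eqt ?eqxx subnn /basis /= re big_nat big1 ?addr0 => [|z zz].
    by rewrite /beta /newton big_ord0 fact0 divr1.
  by rewrite /row_value lr ?eqt ltnS ltnNge (_ : _ <= _)%N //= ?ltnSn //; lia.
Qed.

Lemma rows_mxE r t s : (r < a)%N -> (t < K)%N ->
  rows_mx K cw r t s =
  (if odd r && (s == line_start r) then 2^-1 else 1) * row_value r t s.
Proof.
elim: r s => [|r IH] s ra tK /=.
  rewrite mul1r /row_value /line_start subn0; case: ltnP => // Ks.
  by rewrite tK; case: eqP => // e; move: Ks; rewrite e leqNgt tK.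
rewrite (row_mxE _ (ltnW ra) tK) => [|s']; last exact: IH (ltnW ra) tK.
congr (_ * _); rewrite cwE //.
have -> : row_start K r = line_start r.+1 by rewrite /row_start /line_start; lia.
by case: ltnP => // h; rewrite (ltn_eqF h) andbF.
Qed.

(** The weight of the last row is kept as a separate factor, since its vertical edges cross [l] or
    lead to pendants and do not follow the pattern of the other rows. *)
Lemma rows_mx_last t s : (t < K)%N ->
  rows_mx K cw a t s = cw a.-1 s * basis a t s.
Proof.
move=> tK; have a0 : (0 < a)%N by lia.
rewrite -{1 3}(prednK a0) /= (row_mxE _ _ tK); first last.
- by move=> s'; apply: rows_mxE; lia.
- lia.
rewrite prednK // /row_value (_ : line_start a = 0)%N; last by rewrite /line_start; lia.
by rewrite /= !subn0.
Qed.

End RowsFormula.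

Definition newton_poly (e : bool) (t : nat) : {poly rat} :=
  \prod_(i < t) ('X - (node e i)%:P).

(** The Newton products are monic polynomials of degree [t] in the node, so the matrix is a
    Vandermonde matrix times a unitriangular one. *)
Lemma det_newton e K (x : nat -> nat) :
  \det (\matrix_(j < K, t < K) newton e t (x j)) =
  \prod_(i < K) \prod_(j < K | (i < j)%N) (node e (x j) - node e (x i)).
Proof.
pose xi : 'rV[rat]_K := \row_j node e (x j).
pose C := \matrix_(t < K, k < K) (newton_poly e t)`_k.
have szp t : size (newton_poly e t) = t.+1.
  by rewrite /newton_poly size_prod_XsubC [index_enum _]unlock -enumT size_enum_ord.
have -> : \matrix_(j < K, t < K) newton e t (x j) = (Vandermonde K xi)^T *m C^T.
  apply/matrixP => j t; rewrite !mxE.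
  have -> : newton e t (x j) = (newton_poly e t).[node e (x j)].
    by rewrite horner_prod; apply: eq_bigr => i _; rewrite hornerXsubC.
  rewrite (@horner_coef_wide _ K); last by rewrite szp.
  by apply: eq_bigr => k _; rewrite !mxE mulrC.
rewrite det_mulmx !det_tr det_Vandermonde det_trig; last first.
  by apply/is_trig_mxP => t k tk; rewrite mxE nth_default ?szp.
rewrite [X in _ * X]big1 ?mulr1 => [|t _]; last first.
  rewrite mxE; have /monicP : newton_poly e t \is monic by apply: monic_prod_XsubC.
  by rewrite lead_coefE szp.
by apply: eq_bigr => i _; apply: eq_bigr => j _; rewrite !mxE.
Qed.

Definition vdm (m : nat) (e : bool) (V : {set 'I_m}) : rat :=
  \prod_(i in V) \prod_(j in V | (i < j)%N) (node e j - node e i).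

Definition diag (m : nat) (e : bool) (V : {set 'I_m}) : rat :=
  \prod_(i in V) (if e then 2 * (val i)%:R + 1 else 1).

Definition dent_prod (m : nat) (e : bool) (V : {set 'I_m}) : rat := vdm e V * diag e V.

(* [e] is the parity of the number of rows of a half: [true] for W, where it is
   even, and [false] for Wbar. *)
Definition norm_const (e : bool) (K : nat) : rat :=
  \prod_(t < K) (if e then 2 * ((2 * t).+1`!)%:R else ((2 * t)`!)%:R)^-1.

Lemma vdm_elts m e (V : {set 'I_m}) K : #|V| = K ->
  vdm e V = \prod_(i < K) \prod_(j < K | (i < j)%N)
     (node e (nth 0%N (elts V) j) - node e (nth 0%N (elts V) i)).
Proof.
move=> cV; pose F i j := if (i < j)%N then node e j - node e i else 1.
have -> : vdm e V = \prod_(i in V) \prod_(j in V) F i j.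
  by apply: eq_bigr => i _; rewrite big_mkcondr.
rewrite (eq_bigr (fun i : 'I_m => \prod_(j < K) F i (nth 0%N (elts V) j))); last first.
  by move=> i _; rewrite (big_elts (F i) cV).
rewrite (big_elts (fun i => \prod_(j < K) F i (nth 0%N (elts V) j)) cV).
apply: eq_bigr => i _; rewrite [RHS]big_mkcond /=; apply: eq_bigr => j _.
rewrite /F; congr (if _ then _ else _).
have sz (k : 'I_K) : (k < size (elts V))%N by rewrite size_elts cV.
have mono := sorted_ltn_nth ltn_trans 0%N (sorted_elts V).
have [ij|ji|ij] := ltngtP i j.
- by apply: mono => //; rewrite inE.
- by apply/negbTE; rewrite -leqNgt ltnW //; apply: mono => //; rewrite inE.
- by rewrite ij ltnn.
Qed.

Lemma minor_scale_row m K E (h : nat -> rat) (X : {set 'I_m}) :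
  minor K (fun t s => h t * E t s) X = (\prod_(t < K) h t) * minor K E X.
Proof.
have <- : \det (diag_mx (\row_(t < K) h t)) = \prod_(t < K) h t.
  by rewrite det_diag; apply: eq_bigr => j _; rewrite mxE.
rewrite [RHS]mulrC -det_mulmx mul_mx_diag; congr (\det _); apply/matrixP => j t.
by rewrite !mxE mulrC.
Qed.

Lemma minor_basis m a K (X : {set 'I_m}) : #|X| = K ->
  minor K (basis a) X = norm_const (~~ odd a) K * dent_prod (~~ odd a) X.
Proof.
move=> cX; set e := ~~ odd a.
transitivity (minor K (fun t s => (if e then 2 * ((2 * t).+1`!)%:R else ((2 * t)`!)%:R)^-1 *
   ((if e then 2 * s%:R + 1 else 1) * newton e t s)) X).
  apply: eq_minor => // t s _ _; rewrite /basis /e; case: (odd a) => /=.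
    by rewrite mul1r /beta mulrC.
  by rewrite /alpha [RHS]mulrC.
rewrite minor_scale_row; congr (_ * _).
rewrite (minor_scale _ (fun s => if e then 2 * s%:R + 1 else 1)) // /dent_prod mulrC; congr (_ * _).
by rewrite (vdm_elts _ cX) -det_newton.
Qed.

Lemma prod_sub_add2E m (V : {set 'I_m}) : prod_sub_add2 V = dent_prod false V.
Proof.
rewrite /dent_prod /diag big1 // mulr1; apply: eq_bigr => i _; apply: eq_big => // j _.
by rewrite /seg /node -!natr1; ring.
Qed.

Lemma prod_sub_add1E m (V : {set 'I_m}) :
  prod_sub V * prod_add1 V = dent_prod true V.
Proof.
have -> : prod_add1 V = (\prod_(i in V) \prod_(j in V | (i < j)%N)
    (i%:R + j%:R + 1)) * diag true V.
  rewrite -big_split; apply: eq_bigr => i iV /=.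
  rewrite (bigD1 i) /=; last by rewrite iV leqnn.
  rewrite mulrC; congr (_ * _); last by rewrite /seg -natr1; ring.
  apply: eq_big => [j|j _]; last by rewrite /seg -!natr1; ring.
  by rewrite /seg -andbA; congr (_ && _); rewrite ltnS ltn_neqAle andbC eq_sym.
rewrite mulrA; congr (_ * _); rewrite -big_split; apply: eq_bigr => i iV /=.
rewrite -big_split; apply: eq_big => [j|j _] //=.
by rewrite /seg /node -!natr1; ring.
Qed.

Lemma norm_const_odd K : norm_const false K = (H2 (2 * K))^-1.
Proof.
rewrite /H2 mul2n doubleK odd_double -prodfV; apply: eq_bigr => i _.
by rewrite addn0.
Qed.

Lemma norm_const_even K : norm_const true K = (2 ^+ K * H2 (2 * K + 1))^-1.
Proof.
have -> : 2 ^+ K = \prod_(i < K) 2 :> rat by rewrite prodr_const card_ord.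
rewrite /H2 mul2n addn1 /= uphalf_double odd_double -big_split -prodfV /=.
by apply: eq_bigr => i _; rewrite addn1.
Qed.

(** * Splitting the dent products over disjoint unions *)

(** The absolute value is taken because a dent and an element of [S] may come in either order, while
    [vdm] always subtracts the smaller node. *)
Definition gap (e : bool) (i j : nat) : rat := `|node e j - node e i|.

Lemma nodeB e i j : (i < j)%N -> 0 < node e j - node e i.
Proof.
move=> ij; have : i%:R < j%:R :> rat by rewrite ltr_nat.
have : 0 <= i%:R :> rat by [].
rewrite /node; case: e; nra.
Qed.

Lemma vdm_gt0 m e (V : {set 'I_m}) : 0 < vdm e V.
Proof. by apply: prodr_gt0 => i _; apply: prodr_gt0 => j /andP[_ /nodeB]. Qed.

Lemma diag_gt0 m e (V : {set 'I_m}) : 0 < diag e V.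
Proof. by apply: prodr_gt0 => i _; case: e => //; rewrite ltr_wpDl // mulr_ge0. Qed.

Lemma gap_gt0 e i j : i != j -> 0 < gap e i j.
Proof.
rewrite neq_ltn normr_gt0 => /orP[] /(nodeB e); first by move/lt0r_neq0.
by rewrite -opprB oppr_gt0 => /ltr0_neq0.
Qed.

Lemma prod_setU m (F : 'I_m -> rat) (U S : {set 'I_m}) : [disjoint U & S] ->
  \prod_(i in U :|: S) F i = (\prod_(i in U) F i) * (\prod_(i in S) F i).
Proof.
move=> dis; rewrite (big_setID U) /= setUK setDUl setDv set0U.
by move: dis; rewrite disjoint_sym => /setDidPl ->.
Qed.

Lemma diagU m e (U S : {set 'I_m}) : [disjoint U & S] ->
  diag e (U :|: S) = diag e U * diag e S.
Proof. by move=> dis; rewrite /diag prod_setU. Qed.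

Lemma vdmU m e (U S : {set 'I_m}) : [disjoint U & S] ->
  vdm e (U :|: S) = vdm e U * vdm e S * \prod_(j in S) \prod_(i in U) gap e i j.
Proof.
move=> dis; pose F (i j : 'I_m) := if (i < j)%N then node e j - node e i else 1.
have vE V : vdm e V = \prod_(i in V) \prod_(j in V) F i j.
  by apply: eq_bigr => i _; rewrite big_mkcondr.
rewrite !vE prod_setU //=.
have split_in (V : {set 'I_m}) : \prod_(i in V) \prod_(j in U :|: S) F i j =
    (\prod_(i in V) \prod_(j in U) F i j) * \prod_(i in V) \prod_(j in S) F i j.
  by rewrite -big_split; apply: eq_bigr => i _; rewrite prod_setU.
rewrite !split_in [X in _ * X * _ = _]exchange_big /=.
have -> : \prod_(j in S) \prod_(i in U) gap e i j =
    (\prod_(j in S) \prod_(i in U) F i j) * \prod_(j in S) \prod_(i in U) F j i.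
  rewrite -big_split; apply: eq_bigr => j jS; rewrite -big_split; apply: eq_bigr => i iU /=.
  rewrite /F /gap; have [ij|ji|/val_inj ij] := ltngtP i j.
  - by rewrite mulr1 gtr0_norm ?nodeB.
  - by rewrite mul1r distrC gtr0_norm ?nodeB.
  - by move/pred0P: dis => /(_ j) /=; rewrite jS -ij iU.
by ring.
Qed.

Lemma prod_setUI m (F : 'I_m -> rat) (U D : {set 'I_m}) :
  (\prod_(i in U) F i) * (\prod_(i in D) F i) =
  (\prod_(i in U :|: D) F i) * (\prod_(i in U :&: D) F i).
Proof.
rewrite (big_setID U (A := U :|: D)) /= setUK setDUl setDv set0U.
by rewrite (big_setID U (A := D)) /= [D :&: U]setIC -!mulrA; congr (_ * _); rewrite mulrC.
Qed.

(** * Tilings as permanents *)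

Section Packings.

Variables (T : finType) (good : pred {set T}) (wgt : {set T} -> rat).

Definition packing (O : {set T}) (P : {set {set T}}) : bool :=
  partition P O && [forall L in P, good L].

Definition packing_sum (O : {set T}) : rat :=
  \sum_(P | packing O P) \prod_(L in P) wgt L.

Lemma packing_sum0 : packing_sum set0 = 1.
Proof.
rewrite /packing_sum (big_pred1 set0) ?big_set0 // => P.
rewrite /packing partition_set0 /= andb_idr // => /eqP ->.
by apply/forall_inP => L; rewrite inE.
Qed.

(** The packings are sorted by the tile [L] covering [x]; deleting [L] is a bijection onto the
    packings of the rest. *)
Lemma packing_sum_expand (O : {set T}) x : x \in O ->
  packing_sum O =
  \sum_(L : {set T} | [&& x \in L, L \subset O & good L]) wgt L * packing_sum (O :\: L).
Proof.
move=> xO; rewrite /packing_sum.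
rewrite (partition_big (fun P => pblock P x)
  (fun L => [&& x \in L, L \subset O & good L])) /=; last first.
  move=> P /andP[pP /forall_inP gP].
  have xP : x \in cover P by rewrite (cover_partition pP).
  have LP : pblock P x \in P by rewrite pblock_mem.
  by rewrite mem_pblock xP gP // andbT /= -(cover_partition pP) (bigcup_sup _ LP).
apply: eq_bigr => L /and3P[xL LO gL]; rewrite mulr_sumr.
rewrite (reindex_onto (fun P' => L |: P') (fun P => P :\ L)) /=; last first.
  move=> P /andP[/andP[pP _] /eqP <-]; rewrite setD1K // pblock_mem //.
  by rewrite (cover_partition pP).
apply: eq_big => [P|P].
  apply/idP/idP.
    case/andP => /andP[/andP[pP /forall_inP gP] /eqP pb] /eqP e.
    have LP : L \in L |: P by rewrite setU11.
    apply/andP; split; last by apply/forall_inP => L' L'P; apply: gP; rewrite inE L'P orbT.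
    by rewrite -e; apply: partitionD1.
  case/andP => pP /forall_inP gP.
  have LnP : L \notin P.
    apply/negP => LP; have : x \in cover P by apply/bigcupP; exists L.
    by rewrite (cover_partition pP) inE xL.
  have pLP : partition (L |: P) O.
    rewrite -(setID O L) (setIidPr LO) partitionU1 //.
      by apply/set0Pn; exists x.
    by rewrite -setI_eq0; apply/eqP/setP => y; rewrite !inE; case: (y \in L).
  rewrite setU1K // eqxx andbT; apply/andP; split; last first.
    by rewrite (def_pblock (partition_trivIset pLP) _ xL) // setU11.
  apply/andP; split => //; apply/forall_inP => L'; rewrite !inE => /orP[/eqP-> //|].
  exact: gP.
case/andP => _ /eqP e; rewrite big_setU1 // -e.
by rewrite !inE eqxx.
Qed.

Variables (up : pred T) (w : T -> T -> rat).
Hypothesis goodP : forall L, good L -> exists t t', [/\ up t, ~~ up t' & L = [set t; t']].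
Hypothesis wE : forall t t', up t -> ~~ up t' ->
  w t t' = if good [set t; t'] then wgt [set t; t'] else 0.

(** Induction on the size of [O], expanding both sides at an up cell. If there is none, a nonempty
    [O] has no packing, as every tile contains an up cell, and the permanent is 0 because the
    lengths differ. *)
Lemma packing_sum_pm (O : {set T}) :
  packing_sum O = pm w [seq t <- enum O | up t] [seq t <- enum O | ~~ up t].
Proof.
have [n] := ubnP #|O|; elim: n O => // n IH O /ltnSE On.
have [x /andP[xO ux]|none] := pickP (fun x => (x \in O) && up x); last first.
  have -> : [seq t <- enum O | up t] = [::].
    apply/eqP; rewrite -[_ == _]negbK -has_filter -all_predC; apply/allP => t.
    by rewrite mem_enum => tO /=; move: (none t); rewrite tO /= => ->.
  have [->|[y yO]] := set_0Vmem O.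
    by rewrite packing_sum0 enum_set0.
  rewrite (packing_sum_expand yO) big_pred0 => [|L].
    case e : [seq t <- enum O | ~~ up t] => //=.
    have : y \in [seq t <- enum O | ~~ up t].
      by rewrite mem_filter mem_enum yO andbT; move: (none y); rewrite yO /= => ->.
    by rewrite e.
  apply/negP => /and3P[yL LO /goodP[t [t' [ut _ LE]]]].
  move: (none t); rewrite ut andbT => /negP; apply; apply: (subsetP LO).
  by rewrite LE set21.
have uq (p : pred T) (A : {set T}) : uniq [seq t <- enum A | p t] by rewrite filter_uniq ?enum_uniq.
rewrite (packing_sum_expand xO) (@pm_expand_l _ _ _ _ _ x) ?uq //; last first.
  by rewrite mem_filter ux mem_enum.
pose A := [set t' in O | ~~ up t' && good [set x; t']].
have -> : \sum_(L : {set T} | [&& x \in L, L \subset O & good L]) wgt L * packing_sum (O :\: L) =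
   \sum_(L in (fun t' => [set x; t']) @: A) wgt L * packing_sum (O :\: L).
  apply: eq_bigl => L; apply/and3P/imsetP => [[xL LO gL]|[t']].
    have [t [t' [ut nut LE]]] := goodP gL.
    have tx : t = x.
      move: xL; rewrite LE !inE => /orP[/eqP //|/eqP xt'].
      by rewrite -xt' ux in nut.
    exists t'; last by rewrite LE tx.
    rewrite inE nut -tx -LE gL andbT /= andbT; apply: (subsetP LO).
    by rewrite LE set22.
  rewrite inE => /and3P[t'O nut g] ->; split => //; first exact: set21.
  by rewrite subUset !sub1set xO t'O.
rewrite big_imset /=; last first.
  move=> t1 t2; rewrite !inE => /and3P[_ u1 _] _ e.
  have : t1 \in [set x; t2] by rewrite -e set22.
  by rewrite !inE => /orP[/eqP e1|/eqP //]; rewrite e1 ux in u1.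
rewrite big_filter big_enum_cond /=.
rewrite [RHS]big_mkcond [LHS]big_mkcond /=; apply: eq_bigr => d _.
rewrite inE; case: (boolP (d \in O)) => //= dO; case: (boolP (up d)) => //= nd.
rewrite wE //; case: ifP => g; last by rewrite mul0r.
congr (_ * _); rewrite IH; last first.
  apply: leq_trans On; apply: proper_card; rewrite properE subsetDl.
  by apply/subsetPn; exists x => //; rewrite !inE eqxx.
have memx (p : pred T) y t : (p y) -> (forall t', t' \in [set x; d] -> p t' -> t' = y) ->
    y \in [set x; d] ->
    (t \in [seq t <- enum (O :\: [set x; d]) | p t]) = (t \in rem y [seq t <- enum O | p t]).
  move=> py uqy yin; rewrite mem_filter mem_enum in_setD mem_rem_uniq ?uq // [in RHS]inE mem_filter mem_enum.
  case: (boolP (p t)) => pt //=; rewrite ?andbF //.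
  congr (_ && _); apply/idP/idP => [|ty].
    by apply: contraNneq => ->.
  by apply: contra ty => tin; rewrite (uqy t tin pt).
rewrite (@pm_perm_l _ _ _ _ (rem x [seq t <- enum O | up t])) ?uq //; last first.
  apply: uniq_perm; rewrite ?rem_uniq ?uq // => t; apply: memx => //; last exact: set21.
  by move=> t'; rewrite !inE => /orP[/eqP|/eqP ->] // u; rewrite u in nd.
apply: pm_perm_r; apply: uniq_perm; rewrite ?rem_uniq ?uq // => t; apply: memx => //.
  by move=> t'; rewrite !inE => /orP[/eqP->|/eqP] //; rewrite ux.
exact: set22.
Qed.

End Packings.

Section Region.

Variables (N a b m : nat) (U D B : {set 'I_m}).

Definition at_west (t : nat * int) : bool :=
  [&& west t.1 == t.2, west t.1.+1 == t.2 - 1 & west t.1.+2 == t.2].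

Definition edge_weight (t t' : nat * int) : rat :=
  if lozenge_pair t t' then
    if vertical_pair t t' && [exists k in B, above a (seg k) t] then 0
    else if vertical_pair t t' && at_west t then 2^-1 else 1
  else 0.

Definition in_region (t : nat * int) : bool :=
  [&& inside N a b t, ~~ [exists s in U, above a (seg s) t] &
     ~~ [exists s in D, below a (seg s) t]].

Lemma lozenge_pair_up t t' : lozenge_pair t t' -> up t && ~~ up t'.
Proof.
case: t t' => j c [j' c']; rewrite /lozenge_pair /vertical_pair /up /=.
case/orP=> /and3P[u /eqP -> /=]; first by move/eqP ->; rewrite u; lia.
by case/orP => /eqP ->; rewrite u /=; lia.
Qed.

Lemma pos_inj : injective (@pos N a b).
Proof.
move=> [i j] [i' j'] [e1 e2]; congr (_, _); apply: val_inj => //=; lia.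
Qed.

(** A tile is an unordered pair, but [Q] forces its first argument to point up and its second to
    point down, so the witnesses are determined. *)
Lemma exists_pair (Q : nat * int -> nat * int -> bool) (t t' : tri N a b) :
  (forall s s', Q s s' -> up s && ~~ up s') -> up (pos t) -> ~~ up (pos t') ->
  [exists s, exists s', ([set t; t'] == [set s; s']) && Q (pos s) (pos s')] =
  Q (pos t) (pos t').
Proof.
move=> QP ut ut'; apply/existsP/idP => [[s /existsP[s' /andP[/eqP e q]]]|q]; last first.
  by exists t; apply/existsP; exists t'; rewrite eqxx.
have /andP[us us'] := QP _ _ q.
have : s \in [set t; t'] by rewrite e set21.
have : s' \in [set t; t'] by rewrite e set22.
rewrite !inE => /orP[/eqP e1|/eqP <-]; first by rewrite e1 ut in us'.
by move=> /orP[/eqP <- //|/eqP e1]; rewrite e1 (negPf us') in us.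
Qed.

Lemma tiling_sum_pm us ds : uniq us -> uniq ds ->
  (forall t, (t \in us) = up t && in_region t) ->
  (forall t, (t \in ds) = ~~ up t && in_region t) ->
  tiling_sum N a b U D B = pm edge_weight us ds.
Proof.
move=> uqu uqd mu md.
transitivity (packing_sum (fun L : {set tri N a b} => lozenge L && ~~ barred B L)
   (@weight N a b) (region N a b U D)); first by [].
rewrite (@packing_sum_pm _ _ _ (fun t => up (pos t)) (fun t t' => edge_weight (pos t) (pos t'))).
- rewrite -pm_map; last exact: pos_inj.
  have memr (p : pred (nat * int)) t :
     (t \in [seq pos i | i <- enum (region N a b U D) & p (pos i)]) = p t && in_region t.
    apply/mapP/andP => [[s]|[pt rt]].
      by rewrite mem_filter mem_enum inE => /andP[ps rs] ->.
    have /andP[/inside_box [s sE] _] := rt.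
    by exists s => //; rewrite mem_filter mem_enum inE sE pt.
  rewrite (@pm_perm_l _ _ _ _ us); first last.
  + apply: uniq_perm => //; last by move=> t; rewrite (memr up) mu.
    by rewrite (map_inj_uniq pos_inj) filter_uniq ?enum_uniq.
  + by rewrite (map_inj_uniq pos_inj) filter_uniq ?enum_uniq.
  + by rewrite (map_inj_uniq pos_inj) filter_uniq ?enum_uniq.
  apply: pm_perm_r; apply: uniq_perm => //; last by move=> t; rewrite (memr (predC up)) md.
  by rewrite (map_inj_uniq pos_inj) filter_uniq ?enum_uniq.
- move=> L /andP[/existsP[t /existsP[t' /andP[/eqP LE lp]]] _].
  by exists t, t'; have /andP[] := lozenge_pair_up lp.
move=> t t' ut ut'.
have vl s s' : vertical_pair s s' -> up s && ~~ up s'.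
  by move=> v; apply: lozenge_pair_up; rewrite /lozenge_pair v.
rewrite /edge_weight /weight.
have -> : lozenge [set t; t'] = lozenge_pair (pos t) (pos t').
  exact: exists_pair lozenge_pair_up ut ut'.
have -> : barred B [set t; t'] =
    vertical_pair (pos t) (pos t') && [exists k in B, above a (seg k) (pos t)].
  apply: (@exists_pair (fun s s' => vertical_pair s s' && [exists k in B, above a (seg k) s])) => //.
  by move=> s s' /andP[/vl].
have -> : along_west [set t; t'] = vertical_pair (pos t) (pos t') && at_west (pos t).
  apply: (@exists_pair (fun s s' => vertical_pair s s' && at_west s)) => //.
  by move=> s s' /andP[/vl].
by case: lozenge_pair => //=; case: (_ && _).
Qed.

End Region.

(** * Halves of the region *)

(* Slot [s] of row [r] consists of the down triangle at position [cpos K r s] and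
   of the up triangle to its right.  On line [l], slot [s] is segment [s + 1]. *)
Definition cpos (K r s : nat) : int := r%:Z + 1 + s.*2%:Z - K.*2%:Z.

Definition up_cell (K a m : nat) (t : nat * int) : bool :=
  (t.1 < a)%N && has (fun s => (row_start K t.1 <= s)%N && (t.2 == cpos K t.1 s + 1)) (iota 0 m).

(** In an even row the bound [K - uphalf r] is one more than [row_start K r], which leaves out the
    virtual triangle. *)
Definition down_cell (K a m : nat) (t : nat * int) : bool :=
  (t.1 < a)%N && has (fun s => (K - uphalf t.1 <= s)%N && (t.2 == cpos K t.1 s)) (iota 0 m).

(** In an even row the up triangle of the first slot is at position 0, so the vertical lozenge below
    it lies along the west side. *)
Definition row_weight (K r s : nat) : rat :=
  if ~~ odd r && (s == row_start K r) then 2^-1 else 1.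

Section Half.

Variables (w : nat * int -> nat * int -> rat) (a K m : nat) (fin : nat -> nat * int).
Variables (us0 ds0 us ds : seq (nat * int)) (cf : nat -> rat).
Hypotheses (Ka : uphalf a = K) (Km : (K <= m)%N).
Hypothesis finI : forall s s', (s < m)%N -> (s' < m)%N -> fin s = fin s' -> s = s'.
Hypothesis fin_row : forall s, (a <= (fin s).1)%N.
Hypothesis uqus0 : uniq us0.
Hypothesis uqds0 : uniq ds0.
Hypothesis us0_row : forall t, t \in us0 -> (a <= t.1)%N.
Hypothesis ds0_row : forall t, t \in ds0 -> (a <= t.1)%N.
Hypothesis wE : forall r i r' s, (r < a)%N -> (row_start K r <= i < m)%N ->
  (r' < a)%N -> (row_start K r' <= s < m)%N ->
  w (r, cpos K r i + 1) (r', cpos K r' s) =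
    if r' == r then ((s == i) || (s == i.+1))%:R
    else if (r' == r.+1) && (s == i) then row_weight K r i else 0.
Hypothesis w_us0 : forall u r s, u \in us0 -> (r < a)%N -> (row_start K r <= s < m)%N ->
  w u (r, cpos K r s) = 0.
Hypothesis w_ds0 : forall r i d, (r < a)%N -> (row_start K r <= i < m)%N -> d \in ds0 ->
  w (r, cpos K r i + 1) d = if (r.+1 == a) && (d == fin i) then cf i else 0.
Hypotheses (uqus : uniq us) (uqds : uniq ds).
Hypothesis mem_us : forall t, (t \in us) = up_cell K a m t || (t \in us0).
Hypothesis mem_ds : forall t, (t \in ds) = down_cell K a m t || (t \in ds0).

Let dl r s := if (r < a)%N then (r, cpos K r s) else fin s.
Let ul r s := (r, cpos K r s + 1).

(** [X] is the set of slots through which the last row is left downwards, [fin s] being the one exit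
    of slot [s]. The weight, the exits and the remaining lists stay abstract so that both the upper
    half and the reflected lower half are instances. *)
Lemma half_sum : pm w us ds = \sum_(X : {set 'I_m} | #|X| == K)
  (\prod_(s in X) if fin s \in ds0 then cf s else 0) * minor K (basis a) X *
  pm w us0 [seq d <- ds0 | ~~ hit fin X d].
Proof.
have dl0 r i : (r < a)%N -> dl r i \notin ds0.
  by move=> ra; rewrite /dl ra; apply/negP => /ds0_row /=; lia.
have dlI r r' s s' : (r <= a)%N -> (r' <= a)%N -> (s < m)%N -> (s' < m)%N ->
    dl r s = dl r' s' -> r = r' /\ s = s'.
  move=> ra r'a sm s'm; rewrite /dl; case: ltnP => h; case: ltnP => h'.
  - by case=> -> ; rewrite /cpos; lia.
  - by move=> e; have := fin_row s'; rewrite -e /=; lia.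
  - by move=> e; have := fin_row s; rewrite e /=; lia.
  - by move/finI => e; split; [lia|exact: e].
rewrite (@pm_rows _ _ _ m K a ul dl us0 ds0 (row_weight K) cf _ _ _ _ _ _ _ _ us ds) //.
- apply: eq_bigr => X /eqP cX.
  have hE : [seq d <- ds0 | ~~ hit (dl a) X d] = [seq d <- ds0 | ~~ hit fin X d].
    apply: eq_filter => d; congr (~~ _).
    by apply/hitP/hitP => -[k kX ->]; exists k => //; rewrite /dl ltnn.
  rewrite hE; congr (_ * _); rewrite -(minor_scale _ (fun s => if fin s \in ds0 then cf s else 0) cX); apply: eq_minor => // t s tK sm.
  rewrite (@rows_mx_last _ _ _ Ka) //; last first.
    by move=> r s' ra; rewrite /cell_weight ra.
  congr (_ * _); rewrite /cell_weight /dl ltnn prednK ?ltnn //; lia.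
- apply: uniq_rows_from => // [r r' i i' ra r'a im i'm|r i ra im].
    by rewrite /ul => -[-> ]; rewrite /cpos; lia.
  by apply/negP => /us0_row /=; lia.
- apply: uniq_rows_from => // [r r' i i' ra r'a|r i ra im]; last exact: dl0.
  by apply: dlI; exact: ltnW.
- by move=> r i r' s ra zi r'a zs; rewrite /ul /dl r'a wE.
- by move=> u r s uu ra zs; rewrite /dl ra w_us0.
- by move=> r i d ra zi dd; rewrite /ul /dl ltnn w_ds0.
- move=> t; rewrite mem_us mem_cat; congr (_ || _).
  apply/andP/mem_rows_from => [[ta /hasP[s]]|[[r s] /= h ->]].
    rewrite mem_iota => sm /andP[zs /eqP e]; exists (t.1, s) => /=; first lia.
    by rewrite /ul -e; case: (t).
  split => //=; first lia.
  by apply/hasP; exists s; rewrite ?mem_iota ?eqxx ?andbT; lia.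
- move=> [tr tc]; rewrite mem_ds mem_filter mem_cat.
  have vE r s : (r < a)%N -> (row_start K r <= s < m)%N ->
      hit (fun s => dl (K.-1 - s).*2 s) [set i : 'I_m | (i < K)%N] (dl r s) = (s < K - uphalf r)%N.
    move=> ra zs; apply/hitP/idP => [[k]|sK].
      rewrite inE /= => kK /dlI e; case: e; [lia|lia|lia|exact: ltn_ord|lia].
    have sm : (s < m)%N by lia.
    exists (Ordinal sm); rewrite ?inE /=; first lia.
    by congr (dl _ _); move: zs; rewrite /row_start; lia.
  have t0 : (tr, tc) \in ds0 ->
      ~~ hit (fun s => dl (K.-1 - s).*2 s) [set i : 'I_m | (i < K)%N] (tr, tc).
    move=> td; apply/negP => /hitP[k]; rewrite inE => kK e; move: td; rewrite e.
    by apply/negP; apply: dl0; lia.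
  case: (boolP ((tr, tc) \in ds0)) => td; first by rewrite !orbT t0.
  rewrite !orbF; apply/andP/andP => [[/= ta /hasP[s]]|[hN /mem_rows_from[[r s] /= h e]]].
    rewrite mem_iota => sm /= /andP[zs /eqP e].
    have zs' : (row_start K tr <= s < m)%N by move: zs sm; rewrite /row_start; lia.
    have tE : (tr, tc) = dl tr s by rewrite /dl ta -e.
    split; first by rewrite tE vE //; lia.
    by apply/mem_rows_from; exists (tr, s) => //=; lia.
  have ra : (r < a)%N by lia.
  rewrite e vE -?leqNgt // in hN; last by case/andP: h.
  move: e; rewrite /dl ra => -[-> ->]; split => //=.
  by apply/hasP; exists s; rewrite ?mem_iota ?eqxx ?andbT; lia.
Qed.

End Half.

Lemma slotP (z m : nat) (q c : int) :
  has (fun s => (z <= s)%N && (c == q + s.*2%:Z)) (iota 0 m) =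
  [&& q + z.*2%:Z <= c, c < q + m.*2%:Z & ~~ odd `|c - q|].
Proof.
apply/hasP/and3P => [[s]|[h1 h2 h3]].
  by rewrite mem_iota => sm /andP[zs /eqP ->]; split; lia.
exists (`|c - q|./2); rewrite ?mem_iota; first lia.
by apply/andP; split; [lia|apply/eqP; lia].
Qed.

Lemma up_cellE K a m r c : up_cell K a m (r, c) =
  [&& (r < a)%N, r%:Z + 2 + (row_start K r).*2%:Z - K.*2%:Z <= c,
      c < r%:Z + 2 + m.*2%:Z - K.*2%:Z & up (r, c)].
Proof.
rewrite /up_cell /=; congr (_ && _).
rewrite (eq_has (a2 := fun s => (row_start K r <= s)%N &&
   (c == (r%:Z + 2 - K.*2%:Z) + s.*2%:Z))); last first.
  by move=> s /=; rewrite /cpos; congr (_ && (_ == _)); lia.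
rewrite slotP /up /=; apply/and3P/and3P => -[h1 h2 h3]; split; lia.
Qed.

Lemma down_cellE K a m r c : down_cell K a m (r, c) =
  [&& (r < a)%N, r%:Z + 1 + (K - uphalf r).*2%:Z - K.*2%:Z <= c,
      c < r%:Z + 1 + m.*2%:Z - K.*2%:Z & ~~ up (r, c)].
Proof.
rewrite /down_cell /=; congr (_ && _).
rewrite (eq_has (a2 := fun s => (K - uphalf r <= s)%N &&
   (c == (r%:Z + 1 - K.*2%:Z) + s.*2%:Z))); last first.
  by move=> s /=; rewrite /cpos; congr (_ && (_ == _)); lia.
rewrite slotP /up /=; apply/and3P/and3P => -[h1 h2 h3]; split; lia.
Qed.

Lemma inside_upE N a b r c : up (r, c) -> inside N a b (r, c) =
  [&& (r < a + b)%N, (odd r)%:Z <= c &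
      c <= if (r < a)%N then (N.*2 + r)%:Z else (N.*2 + a.*2)%:Z - r%:Z - 2].
Proof.
move=> u; rewrite /inside /vertices u /= /west /= /east; congr (_ && _); move: u => _.
case: (ltnP r a) => ra; first rewrite (ltnW ra); last (rewrite [(r <= a)%N]leq_eqVlt ltnNge ra orbF);
  by case: (odd r) => /=; try (case: eqP => e); apply/idP/idP; lia.
Qed.

Lemma inside_downE N a b r c : ~~ up (r, c) -> inside N a b (r, c) =
  [&& (r < a + b)%N, (~~ odd r)%:Z <= c &
      c <= if (r < a)%N then (N.*2 + r)%:Z - 1 else (N.*2 + a.*2)%:Z - r%:Z - 1].
Proof.
move=> u; rewrite /inside /vertices (negPf u) /= /west /= /east; congr (_ && _); move: u => _.
case: (ltnP r a) => ra; first rewrite (ltnW ra); last (rewrite [(r <= a)%N]leq_eqVlt ltnNge ra orbF);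
  by case: (odd r) => /=; try (case: eqP => e); apply/idP/idP; lia.
Qed.

Lemma up_lt r c (u : int) : up (r, c) ->
  (c < r%:Z + 2 + u * 2) = (c <= r%:Z + u * 2).
Proof. by rewrite /up /= => p; apply/idP/idP; lia. Qed.

Lemma down_lt r c (u : int) : ~~ up (r, c) ->
  (c < r%:Z + 1 + u * 2) = (c <= r%:Z - 1 + u * 2).
Proof. by rewrite /up /= => p; apply/idP/idP; lia. Qed.

Lemma up_cell_lower K r : (r./2 < K)%N ->
  r%:Z + 2 + (row_start K r).*2%:Z - K.*2%:Z = (odd r)%:Z.
Proof. by rewrite /row_start; lia. Qed.

Lemma down_cell_lower K r : (uphalf r <= K)%N ->
  r%:Z + 1 + (K - uphalf r).*2%:Z - K.*2%:Z = (~~ odd r)%:Z.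
Proof. by lia. Qed.

Lemma up_cell_bounds K a m r c : uphalf a = K -> (r < a)%N ->
  up_cell K a m (r, c) =
  [&& up (r, c), (odd r)%:Z <= c & c <= r%:Z + (m%:Z - K%:Z) * 2].
Proof.
move=> Ka ra; rewrite up_cellE ra /= up_cell_lower; last lia.
rewrite andbA andbC; case: (boolP (up (r, c))) => u //=; congr (_ && _).
by rewrite -up_lt //; congr (_ < _); lia.
Qed.

Lemma down_cell_bounds K a m r c : uphalf a = K -> (r < a)%N ->
  down_cell K a m (r, c) =
  [&& ~~ up (r, c), (~~ odd r)%:Z <= c & c <= r%:Z - 1 + (m%:Z - K%:Z) * 2].
Proof.
move=> Ka ra; rewrite down_cellE ra /= down_cell_lower; last lia.
rewrite andbA andbC; case: (boolP (up (r, c))) => u //=; congr (_ && _).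
by rewrite -down_lt //; congr (_ < _); lia.
Qed.

Section Geometry.

Variables (N a b m K K' : nat).
Hypotheses (Ka : uphalf a = K) (NK : (N + K = m)%N).

Lemma inside_up_top r c : (r < a)%N ->
  up (r, c) && inside N a b (r, c) = up_cell K a m (r, c).
Proof.
move=> ra; rewrite (up_cell_bounds _ _ Ka) //; case: (boolP (up (r, c))) => u //=.
rewrite inside_upE // ra ltn_addr //=; congr (_ && (_ <= _)); lia.
Qed.

Lemma inside_down_top r c : (r < a)%N ->
  ~~ up (r, c) && inside N a b (r, c) = down_cell K a m (r, c).
Proof.
move=> ra; rewrite (down_cell_bounds _ _ Ka) //; case: (boolP (up (r, c))) => u //=.
rewrite inside_downE // ra ltn_addr //=; congr (_ && (_ <= _)); lia.
Qed.

Hypotheses (Kb : uphalf b = K') (ab : odd a = odd b) (Km : (K' <= m)%N).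

Let refl_up r c : (r < a + b)%N -> up ((a + b).-1 - r, c)%N = ~~ up (r, c).
Proof. by move=> rab; rewrite /up /=; lia. Qed.

Let refl_odd r : (r < a + b)%N -> odd ((a + b).-1 - r) = ~~ odd r.
Proof. by lia. Qed.

Lemma inside_down_bot r c : (a <= r)%N ->
  ~~ up (r, c) && inside N a b (r, c) = (r < a + b)%N && up_cell K' b m ((a + b).-1 - r, c)%N.
Proof.
move=> ra; case: (boolP (up (r, c))) => u /=; case: (ltnP r (a + b)) => rab //=.
- by rewrite (up_cell_bounds _ _ Kb) ?refl_up ?u //; lia.
- rewrite inside_downE // rab /= (up_cell_bounds _ _ Kb) ?refl_up ?u ?refl_odd //; last lia.
  by rewrite ltnNge ra /=; congr (_ && (_ <= _)); lia.
- by rewrite /inside /= ltnNge rab.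
Qed.

Lemma inside_up_bot r c : (a <= r)%N ->
  up (r, c) && inside N a b (r, c) = (r < a + b)%N && down_cell K' b m ((a + b).-1 - r, c)%N.
Proof.
move=> ra; case: (boolP (up (r, c))) => u /=; case: (ltnP r (a + b)) => rab //=.
- rewrite inside_upE // rab /= (down_cell_bounds _ _ Kb) ?refl_up ?u ?refl_odd ?negbK //; last lia.
  by rewrite ltnNge ra /=; congr (_ && (_ <= _)); lia.
- by rewrite /inside /= ltnNge rab.
- by rewrite (down_cell_bounds _ _ Kb) ?refl_up ?u //; lia.
Qed.

End Geometry.

(** Each [g i] has [f i] as its only neighbour, with weight 1, so these pairs are forced and can be
    added or deleted freely. *)
Lemma pm_pendants (T S I : eqType) (w : T -> S -> rat) (l : seq I) (f : I -> T) (g : I -> S)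
    us ds : uniq ([seq f i | i <- l] ++ us) -> uniq ([seq g i | i <- l] ++ ds) ->
  {in l, forall i, w (f i) (g i) = 1} ->
  (forall i v, i \in l -> v \in [seq f i | i <- l] ++ us -> v != f i -> w v (g i) = 0) ->
  pm w ([seq f i | i <- l] ++ us) ([seq g i | i <- l] ++ ds) = pm w us ds.
Proof.
elim: l => [|i l IH] // uf ug w1 w0; move: (uf) (ug) => /= /andP[nf uf'] /andP[ng ug'].
rewrite -/(pm w (f i :: _) (g i :: _)) (@pm_forced _ _ _ _ _ (f i) (g i)) //; try exact: mem_head.
- rewrite w1 ?mem_head // mul1r /= !eqxx IH // => [j jl|j v jl vl vj].
    by apply: w1; rewrite inE jl orbT.
  by apply: w0; rewrite ?inE ?jl ?vl ?orbT.
- by move=> v vl vi; apply: w0; rewrite ?mem_head.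
Qed.

Lemma cpos_inj K r : injective (cpos K r).
Proof. by move=> s s'; rewrite /cpos; lia. Qed.

Lemma cpos_midseg a K s : uphalf a = K -> midseg a s.+1 = cpos K a s.
Proof. by move=> Ka; rewrite /midseg /west /cpos; lia. Qed.

Lemma cpos_parity a b K K' s : uphalf a = K -> uphalf b = K' -> odd a = odd b ->
  cpos K a s = cpos K' b s.
Proof. by move=> *; rewrite /cpos; lia. Qed.

Lemma up_cell_last K a m s : uphalf a = K -> (0 < a)%N -> (s < m)%N ->
  up_cell K a m (a.-1, cpos K a s).
Proof.
move=> Ka a0 sm; apply/andP; split; rewrite /=; first lia.
apply/hasP; exists s; first by rewrite mem_iota.
by rewrite /cpos /row_start; apply/andP; split; [lia|apply/eqP; lia].
Qed.

Section Lists.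

Variables (N a b : nat).

Definition triangles (p : pred (nat * int)) : seq (nat * int) :=
  [seq t <- [seq pos t | t : tri N a b] | p t].

Lemma uniq_triangles p : uniq (triangles p).
Proof. by rewrite filter_uniq // map_inj_uniq ?enum_uniq //; exact: pos_inj. Qed.

Lemma mem_triangles (p : pred (nat * int)) t : (forall t, p t -> inside N a b t) ->
  (t \in triangles p) = p t.
Proof.
move=> pI; rewrite mem_filter; case: (boolP (p t)) => //= /pI /inside_box[t' <-].
by rewrite map_f // mem_enum.
Qed.

End Lists.

Lemma edge_weight_row a m (B : {set 'I_m}) K r i s : 
  edge_weight a B (r, cpos K r i + 1) (r, cpos K r s) = ((s == i) || (s == i.+1))%:R.
Proof.
rewrite /edge_weight /lozenge_pair /vertical_pair /= (ltn_eqF (ltnSn r)) andbF /= eqxx /=.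
have -> : up (r, cpos K r i + 1) by rewrite /up /cpos /=; lia.
have -> : cpos K r s == cpos K r i + 1 - 1 = (s == i) by rewrite /cpos; lia.
have -> : cpos K r s == cpos K r i + 1 + 1 = (s == i.+1) by rewrite /cpos; lia.
by case: (_ || _).
Qed.

Lemma at_westE r c : at_west (r, c) = ~~ odd r && (c == 0).
Proof. by rewrite /at_west /west /=; lia. Qed.

Section Edge.

Variables (a m : nat) (B : {set 'I_m}).

Lemma edge_weight_far r c r' c' : r' != r -> r' != r.+1 ->
  edge_weight a B (r, c) (r', c') = 0.
Proof.
by move=> /negPf h1 /negPf h2; rewrite /edge_weight /lozenge_pair /vertical_pair /= h1 h2 !andbF.
Qed.

Lemma edge_weight_vert r c c' : up (r, c) ->
  edge_weight a B (r, c) (r.+1, c') =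
  if c' == c then
    if [exists k in B, above a (seg k) (r, c)] then 0
    else if ~~ odd r && (c == 0) then 2^-1 else 1
  else 0.
Proof.
move=> u; rewrite /edge_weight /lozenge_pair /vertical_pair u eqxx /= (gtn_eqF (ltnSn r)) /= orbF.
by rewrite at_westE; case: eqP.
Qed.

Lemma edge_weight_row_down K r r' i s : up (r', cpos K r s) ->
  edge_weight a B (r', cpos K r s) (r', cpos K r i + 1) = ((s == i) || (s == i.+1))%:R.
Proof.
move=> u; rewrite /edge_weight /lozenge_pair /vertical_pair u /= (ltn_eqF (ltnSn r')) /= eqxx /=.
have -> : cpos K r i + 1 == cpos K r s - 1 = (s == i.+1) by rewrite /cpos; lia.
have -> : cpos K r i + 1 == cpos K r s + 1 = (s == i) by rewrite /cpos; lia.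
by rewrite orbC; case: (_ || _).
Qed.

End Edge.

Lemma up_cpos K r i : up (r, cpos K r i + 1).
Proof. by rewrite /up /cpos /=; lia. Qed.

Section Bottom.

Variables (N a b m K K' : nat) (B V : {set 'I_m}).
Hypotheses (Ka : uphalf a = K) (Kb : uphalf b = K') (ab : odd a = odd b).
Hypotheses (NK : (N + K = m)%N) (Km : (K' <= m)%N) (cV : #|V| = K').

(** The identity outside the outline, which makes [mir] an involution, hence injective, on all
    positions. *)
Let mir (t : nat * int) : nat * int :=
  if (t.1 < a + b)%N then ((a + b).-1 - t.1, t.2)%N else t.

Let mirK : involutive mir.
Proof.
move=> [r c]; rewrite /mir /=; case: (ltnP r (a + b)) => h /=; last by rewrite ltnNge h.
by rewrite ifT; [congr (_, _); lia|lia].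
Qed.

(* The lower half, reflected in a horizontal line.  A removed triangle of its last
   row is put back together with a pendant partner in the fictitious row
   [(a + b).+1]; the same device is used in [top_weight]. *)
Definition mirror_weight (t s : nat * int) : rat :=
  if s.1 == (a + b).+1 then ((t.1.+1 == b) && (t.2 == s.2))%:R
  else edge_weight a B (mir s) (mir t).

Let ups := triangles N a b (fun t => [&& up t, inside N a b t & (a <= t.1)%N]).
Let downs := triangles N a b (fun t =>
  [&& ~~ up t, inside N a b t, (a <= t.1)%N & ~~ hit (fun s => (a, cpos K a s)) V t]).
Let cell (s : 'I_m) : nat * int := (b.-1, cpos K' b s).
Let pend (s : 'I_m) : nat * int := ((a + b).+1, cpos K' b s).

Let cpos_ab s : cpos K a s = cpos K' b s.
Proof. exact: cpos_parity. Qed.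

Let mem_ups t : (t \in ups) = [&& up t, inside N a b t & (a <= t.1)%N].
Proof. by rewrite mem_triangles // => s /and3P[]. Qed.

Let mem_downs t : (t \in downs) =
  [&& ~~ up t, inside N a b t, (a <= t.1)%N & ~~ hit (fun s => (a, cpos K a s)) V t].
Proof. by rewrite mem_triangles // => s /and4P[]. Qed.

Let mem_map_mir (l : seq (nat * int)) t : (t \in [seq mir u | u <- l]) = (mir t \in l).
Proof. by rewrite -{1}(mirK t) mem_map //; exact: inv_inj mirK. Qed.

(** Once the missing triangles are restored, the reflected half is complete and its only exits are
    the pendants of [V]. Exactly [K'] slots must be left and [V] has [K'] elements, so the sum of
    [half_sum] reduces to the term [X = V]. *)
Lemma bottom_sum : pm (edge_weight a B) ups downs = minor K' (basis b) V.
Proof.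
have uq l : uniq l -> uniq [seq mir u | u <- l].
  by move=> u; rewrite map_inj_uniq //; exact: inv_inj mirK.
have uqe : uniq (enum V) by exact: enum_uniq.
have V0 (k : 'I_m) : k \in V -> (0 < b)%N.
  by move=> kV; have : (0 < #|V|)%N by [apply/card_gt0P; exists k]; lia.
have ltab t : t \in ups -> (t.1 < a + b)%N.
  by rewrite mem_ups => /and3P[_ /andP[]].
have mirab t : (mir t).1 != (a + b).+1 -> t.1 != (a + b).+1.
  by rewrite /mir; case: ltnP => //; lia.
have mirE r c : (r < b)%N -> mir (r, c) = ((a + b).-1 - r, c)%N.
  by move=> rb; rewrite /mir /= ifT //; lia.
have hitE t : (t.1 < b)%N ->
    (t \in [seq cell s | s <- enum V]) = hit (fun s => (a, cpos K a s)) V (mir t).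
  case: t => r c /= rb; rewrite mirE //; apply/mapP/hitP => -[s].
    by rewrite mem_enum => sV [rE ->]; exists s => //; rewrite cpos_ab; congr (_, _); lia.
  by move=> sV [rE ->]; exists s; rewrite ?mem_enum // cpos_ab /cell; congr (_, _); lia.
have cell_up s : s \in V -> up_cell K' b m (cell s).
  by move=> sV; apply: up_cell_last; rewrite ?(V0 _ sV).
have out t : (b <= t.1)%N -> inside N a b (mir t) && (a <= (mir t).1)%N = false.
  case: t => r c /= rb; rewrite /mir /=; case: (ltnP r (a + b)) => h; last first.
    by rewrite /inside /= ltnNge h.
  by rewrite andbC /= leqNgt (_ : _ < a)%N //; lia.
have mu t : (t \in [seq cell s | s <- enum V] ++ [seq mir u | u <- downs]) = up_cell K' b m t.
  rewrite mem_cat mem_map_mir mem_downs; case: (ltnP t.1 b) => tb; last first.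
    have -> : up_cell K' b m t = false by rewrite /up_cell ltnNge tb.
    apply/negbTE; rewrite negb_or; apply/andP; split.
      apply/mapP => -[s]; rewrite mem_enum => /V0 b0 e; move: tb; rewrite e /=; lia.
    by apply/negP => /and4P[_ i1 i2 _]; move: (out t tb); rewrite i1 i2.
  rewrite hitE //; case: t tb => r c /= rb; rewrite mirE //.
  rewrite (andbA (~~ up _)) (@inside_down_bot _ _ _ m K K') //; last lia.
  rewrite (_ : (a + b).-1 - ((a + b).-1 - r) = r)%N; last lia.
  rewrite (_ : (a + b).-1 - r < a + b)%N; last lia.
  rewrite (_ : a <= (a + b).-1 - r)%N /=; last lia.
  case: (boolP (hit _ _ _)) => h /=; last by rewrite andbT.
  have : (r, c) \in [seq cell s | s <- enum V] by rewrite hitE // mirE.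
  by case/mapP => s; rewrite mem_enum => sV ->; rewrite cell_up.
have md t : (t \in [seq mir u | u <- ups]) = down_cell K' b m t.
  rewrite mem_map_mir mem_ups; case: (ltnP t.1 b) => tb; last first.
    by rewrite out // andbF /down_cell ltnNge tb.
  case: t tb => r c /= rb; rewrite mirE //.
  rewrite (andbA (up _)) (@inside_up_bot _ _ _ m K K') //; last lia.
  rewrite (_ : (a + b).-1 - ((a + b).-1 - r) = r)%N; last lia.
  rewrite (_ : (a + b).-1 - r < a + b)%N; last lia.
  by rewrite (_ : a <= (a + b).-1 - r)%N /= ?andbT //; lia.
have uqU : uniq ([seq cell s | s <- enum V] ++ [seq mir u | u <- downs]).
  rewrite cat_uniq uq ?uniq_triangles // andbT map_inj_uniq ?uqe /=; last first.
    by move=> s s' [] /cpos_inj /val_inj.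
  apply/hasPn => t; rewrite mem_map_mir mem_downs => /and4P[_ i1 i2].
  apply: contra => tc; rewrite -hitE //; rewrite ltnNge; apply/negP => /out.
  by rewrite i1 i2.
have uqD : uniq ([seq pend s | s <- enum V] ++ [seq mir u | u <- ups]).
  rewrite cat_uniq uq ?uniq_triangles // andbT map_inj_uniq ?uqe /=; last first.
    by move=> s s' [] /cpos_inj /val_inj.
  apply/hasPn => t; rewrite md => /andP[tb _]; apply/negP => /mapP[s _ e].
  by move: tb; rewrite e /=; lia.
(* The reflection exchanges up and down triangles, hence the transposed permanent. *)
rewrite pm_tr ?uniq_triangles //.
transitivity (pm mirror_weight [seq mir u | u <- downs] [seq mir u | u <- ups]).
  rewrite pm_map; last exact: inv_inj mirK.
  apply: eq_pm => d u _ uu; rewrite /mirror_weight !mirK ifN //.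
  by rewrite /mir (ltab _ uu) /=; have := ltab _ uu; lia.
rewrite -(@pm_pendants _ _ _ _ (enum V) cell pend) //; first last.
- move=> i v _ _ vi; rewrite /mirror_weight /= eqxx; case: andP => // -[/eqP v1 /eqP v2].
  by case/eqP: vi; rewrite (surjective_pairing v) v2 /cell; congr (_, _); rewrite -v1.
- move=> i; rewrite mem_enum => /V0 b0; rewrite /mirror_weight /= eqxx prednK //.
  by rewrite !eqxx.
rewrite (@half_sum mirror_weight b K' m (fun s => ((a + b).+1, cpos K' b s))
  [::] [seq pend s | s <- enum V] _ _ (fun=> 1)) //.
- rewrite (bigD1 V) ?cV ?eqxx //= [X in _ + X]big1 ?addr0 => [|X /andP[/eqP cX XV]].
    rewrite big1 ?mul1r => [|s sV]; last by rewrite (map_f pend) ?mem_enum.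
    rewrite (_ : [seq d <- _ | _] = [::]) ?mulr1 //.
    apply/eqP; rewrite -[_ == _]negbK -has_filter; apply/hasPn => t /mapP[s].
    by rewrite mem_enum => sV ->; rewrite negbK; apply/hitP; exists s.
  have /subsetPn[s sX sV] : ~~ (X \subset V).
    by apply: contra XV => XV; rewrite eqEcard XV cX cV leqnn.
  rewrite (bigD1 s) //= ifN ?mul0r //; apply: contra sV => /mapP[k].
  by rewrite mem_enum => kV [] /cpos_inj /val_inj ->.
- by move=> s s' _ _ [] /cpos_inj.
- by move=> s /=; lia.
- by rewrite map_inj_uniq // => s s' [] /cpos_inj /val_inj.
- by move=> t /mapP[s _ ->] /=; lia.
- move=> r i r' s rb zi r'b zs; rewrite /mirror_weight /= ifN; last lia.
  rewrite !mirE //; case: eqP => [->|rr].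
    by rewrite edge_weight_row_down //; rewrite /up /cpos /=; lia.
  case: eqP => [e|rr']; last by rewrite edge_weight_far //; lia.
  subst r'.
  rewrite (_ : (a + b).-1 - r = ((a + b).-1 - r.+1).+1)%N; last lia.
  rewrite edge_weight_vert; last by rewrite /up /cpos /=; lia.
  have -> : cpos K' r i + 1 == cpos K' r.+1 s = (s == i) by rewrite /cpos; lia.
  case: eqP => // ->; rewrite ifN; last first.
    by apply/exists_inP => -[k _ /andP[/= /eqP h _]]; lia.
  (* As [a + b] is even, the upper row of the original lozenge has the parity of [r], so the weights
     1/2 are where the unreflected sweep has them. *)
  rewrite /row_weight; congr (if _ then _ else _).
  by move: zi; rewrite /row_start /cpos; lia.
- move=> r i d rb zi /mapP[k _ ->]; rewrite /mirror_weight /= eqxx.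
  case: eqP => //= rE; have -> : cpos K' r i + 1 = cpos K' b i by rewrite /cpos; lia.
  by rewrite /pend -pair_eqE /= eqxx /= eq_sym; case: eqP.
- by move=> t; rewrite mu orbF.
- by move=> t; rewrite mem_cat md orbC.
Qed.

End Bottom.

Section Top.

Variables (N a b m K K' y : nat) (U D B : {set 'I_m}).
Hypotheses (Ka : uphalf a = K) (Kb : uphalf b = K') (ab : odd a = odd b).
Hypotheses (NK : (N + K = m)%N) (Km : (K' <= m)%N).
Hypotheses (cU : (#|U| + y = K)%N) (cD : (#|D| + y = K')%N).

Let line (s : nat) : nat * int := (a, cpos K a s).
Let cell (s : 'I_m) : nat * int := (a.-1, cpos K a s).
Let pend (s : nat) : nat * int := ((a + b).+1, cpos K a s).
Let inU (s : nat) : bool := s \in elts U.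
Let final (s : nat) : nat * int := if inU s then pend s else line s.

Let ups0 := triangles N a b (fun t => [&& up t, inside N a b t & (a <= t.1)%N]).
Let downs0 := triangles N a b (fun t =>
  [&& ~~ up t, inside N a b t, (a <= t.1)%N & ~~ hit line D t]).
Let upsR := triangles N a b (fun t => up t && in_region N a b U D t).
Let downsR := triangles N a b (fun t => ~~ up t && in_region N a b U D t).

(** The second case cuts the edge across [l] in the slots of [U]: the triangle below may still be
    present there, while [half_sum] allows one exit per slot, which for these is the pendant. *)
Definition top_weight (t s : nat * int) : rat :=
  if s.1 == (a + b).+1 then ((t.1.+1 == a) && (t.2 == s.2))%:R
  else if [&& s.1 == a, t.1.+1 == a & hit line U (a, t.2)] then 0
  else edge_weight a B t s.

(** For odd [a] the upper row [a.-1] is even and slot 0 of [l] is at position 0, so the lozenge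
    crossing there lies along the west side; for even [a] no crossing lozenge does. *)
Definition line_weight (s : nat) : rat :=
  if s \in elts B then 0 else if odd a && (s == 0)%N then 2^-1 else 1.

Let mem_ups0 t : (t \in ups0) = [&& up t, inside N a b t & (a <= t.1)%N].
Proof. by rewrite mem_triangles // => s /and3P[]. Qed.

Let mem_downs0 t : (t \in downs0) =
  [&& ~~ up t, inside N a b t, (a <= t.1)%N & ~~ hit line D t].
Proof. by rewrite mem_triangles // => s /and4P[]. Qed.

Let mem_upsR t : (t \in upsR) = up t && in_region N a b U D t.
Proof. by rewrite mem_triangles // => s /andP[_ /and3P[]]. Qed.

Let mem_downsR t : (t \in downsR) = ~~ up t && in_region N a b U D t.
Proof. by rewrite mem_triangles // => s /andP[_ /and3P[]]. Qed.

Lemma aboveE (s : 'I_m) t : above a (seg s) t = (t.1.+1 == a) && (t.2 == cpos K a s).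
Proof. by rewrite /above /seg (cpos_midseg _ Ka). Qed.

Lemma belowE (s : 'I_m) t : below a (seg s) t = (t == line s).
Proof. by rewrite /below /seg (cpos_midseg _ Ka) /line; case: t. Qed.

Lemma line_down (s : nat) : ~~ up (line s).
Proof. by rewrite /up /line /cpos /=; lia. Qed.

Lemma tiling_sum_top : tiling_sum N a b U D B =
  \sum_(X : {set 'I_m} | #|X| == K)
   (\prod_(s in X) if final s \in downs0 ++ [seq pend s | s <- elts U]
      then (if inU s then 1 else line_weight s) else 0) * minor K (basis a) X *
    pm top_weight ups0 [seq d <- downs0 ++ [seq pend s | s <- elts U] | ~~ hit final X d].
Proof.
have U0 (k : 'I_m) : k \in U -> (0 < a)%N.
  by move=> kU; have : (0 < #|U|)%N by [apply/card_gt0P; exists k]; lia.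
have notpend t : inside N a b t -> t.1 != (a + b).+1 by case/andP; lia.
have pendE : [seq pend s | s <- elts U] = [seq pend (val s) | s <- enum U] by rewrite -map_comp.
rewrite (@tiling_sum_pm _ _ _ _ _ _ _ upsR downsR) ?uniq_triangles //.
have abE t : [exists s in U, above a (seg s) t] = (t \in [seq cell s | s <- enum U]).
  apply/exists_inP/mapP => -[s sU].
    rewrite aboveE => /andP[/eqP ta /eqP tc]; exists s; rewrite ?mem_enum //.
    by rewrite (surjective_pairing t) tc /cell; congr (_, _); rewrite -ta.
  rewrite mem_enum in sU => ->; exists s => //; rewrite aboveE /= eqxx andbT prednK //.
  exact: U0 sU.
have blE t : [exists s in D, below a (seg s) t] = hit line D t.
  apply/exists_inP/hitP => -[s sD]; first by rewrite belowE => /eqP e; exists s.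
  by move=> e; exists s => //; rewrite belowE e.
have cellP t : t \in [seq cell s | s <- enum U] -> up_cell K a m t.
  case/mapP => s; rewrite mem_enum => sU ->.
  by apply: up_cell_last; rewrite ?(U0 _ sU).
have upc t : up_cell K a m t -> up t && (t.1 < a)%N.
  by case: t => r c; rewrite up_cellE => /and4P[-> _ _ ->].
have mu t : (t \in [seq cell s | s <- enum U] ++ upsR) = up_cell K a m t || (t \in ups0).
  rewrite mem_cat mem_upsR mem_ups0 /in_region abE blE; case: (ltnP t.1 a) => ta.
    rewrite andbF andbF orbF; case: (boolP (t \in [seq cell s | s <- enum U])) => tc /=.
      by rewrite cellP.
    have -> : hit line D t = false by apply/hitP => -[s _ e]; move: ta; rewrite e /= ltnn.
    by rewrite !andbT; case: t ta {tc} => r c /= ta; rewrite (inside_up_top _ Ka NK).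
  have -> : up_cell K a m t = false by apply/negP => /upc; rewrite ltnNge ta andbF.
  have tc : t \in [seq cell s | s <- enum U] = false.
    by apply/negP => /cellP/upc; rewrite ltnNge ta andbF.
  rewrite tc /= andbT; case: (boolP (up t)) => //= ut; rewrite (_ : hit line D t = false) ?andbT //.
  by apply/hitP => -[s _ e]; move: ut; rewrite e; apply/negP; exact: line_down.
have md t : (t \in [seq pend (val s) | s <- enum U] ++ downsR) =
    down_cell K a m t || (t \in downs0 ++ [seq pend (val s) | s <- enum U]).
  rewrite !mem_cat mem_downsR mem_downs0 /in_region abE blE orbA orbC; congr (_ || _).
  case: (boolP (up t)) => ut /=.
    by rewrite orbF; case: t ut => r c ut; rewrite down_cellE ut !andbF.
  have -> : t \in [seq cell s | s <- enum U] = false.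
    by apply/negP => /cellP/upc; rewrite (negPf ut).
  case: (ltnP t.1 a) => ta; rewrite /= ?andbF ?andbT.
    have -> : hit line D t = false by apply/hitP => -[s _ e]; move: ta; rewrite e /= ltnn.
    rewrite orbF andbT; case: t ta ut => r c /= ta ut.
    by rewrite -(inside_down_top b Ka NK) // ut.
  by rewrite /down_cell ltnNge ta.
have uqU : uniq ([seq cell s | s <- enum U] ++ upsR).
  rewrite cat_uniq uniq_triangles andbT map_inj_uniq ?enum_uniq /=; last first.
    by move=> s s' [] /cpos_inj /val_inj.
  by apply/hasPn => t; rewrite mem_upsR /in_region abE => /and4P[].
have uqD : uniq ([seq pend (val s) | s <- enum U] ++ downsR).
  rewrite cat_uniq uniq_triangles andbT map_inj_uniq ?enum_uniq /=; last first.
    by move=> s s' [] /cpos_inj /val_inj.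
  apply/hasPn => t; rewrite mem_downsR => /and3P[_ /notpend ti _].
  by apply/negP => /mapP[s _ e]; move: ti; rewrite e eqxx.
transitivity (pm top_weight upsR downsR).
  apply: eq_pm => t s tu sd; rewrite /top_weight.
  have /negPf -> : s.1 != (a + b).+1.
    by apply: notpend; move: sd; rewrite mem_downsR => /and3P[].
  rewrite ifN //; apply/negP => /and3P[_ /eqP ta /hitP[k kU [tc]]].
  move: tu; rewrite mem_upsR /in_region => /and4P[_ _ /exists_inP[]]; exists k => //.
  by rewrite aboveE ta eqxx tc /=.
rewrite -(@pm_pendants _ _ _ _ (enum U) cell (fun s => pend (val s))) //; first last.
- move=> i v _ _ vi; rewrite /top_weight /= eqxx; case: andP => // -[/eqP v1 /eqP v2].
  by case/eqP: vi; rewrite (surjective_pairing v) v2 /cell; congr (_, _); rewrite -v1.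
- move=> i; rewrite mem_enum => /U0 a0; rewrite /top_weight /= eqxx prednK //.
  by rewrite !eqxx.
rewrite (@half_sum top_weight a K m final ups0 (downs0 ++ [seq pend (val s) | s <- enum U]) _ _
   (fun s => if inU s then 1 else line_weight s)) //.
- by rewrite pendE.
- lia.
- move=> s s' _ _; rewrite /final; do 2 case: ifP => _; case; try (by move/cpos_inj); lia.
- by move=> s; rewrite /final; case: ifP => _ /=; lia.
- exact: uniq_triangles.
- rewrite uniq_catC cat_uniq uniq_triangles andbT map_inj_uniq ?enum_uniq /=; last first.
    by move=> s s' [] /cpos_inj /val_inj.
  apply/hasPn => t; rewrite mem_downs0 => /and4P[_ /notpend ti _ _].
  by apply/negP => /mapP[s _ e]; move: ti; rewrite e eqxx.
- by move=> t; rewrite mem_ups0 => /and3P[].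
- move=> t; rewrite mem_cat mem_downs0 => /orP[/and4P[] //|/mapP[s _ ->]] /=; lia.
- move=> r i r' s ra zi r'a zs; rewrite /top_weight /= ifN; last lia.
  rewrite ifN; last by rewrite (ltn_eqF r'a).
  case: eqP => [->|rr]; first by rewrite edge_weight_row.
  case: eqP => [e|rr']; last by rewrite edge_weight_far //; apply/eqP.
  subst r'; rewrite edge_weight_vert ?up_cpos //.
  have -> : cpos K r.+1 s == cpos K r i + 1 = (s == i) by rewrite /cpos; lia.
  case: eqP => // _; rewrite ifN; last first.
    by apply/exists_inP => -[k _ /andP[/= /eqP h _]]; lia.
  rewrite /row_weight; congr (if _ then _ else _).
  by move: zi; rewrite /row_start /cpos; lia.
- move=> u r s; rewrite mem_ups0 => /and3P[_ _ ua] ra zs; rewrite /top_weight /= ifN; last lia.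
  rewrite ifN; last by rewrite (ltn_eqF ra).
  by case: u ua => r' c /= ua; rewrite edge_weight_far //; lia.
- move=> r i d ra zi; rewrite mem_cat => /orP[|].
  + rewrite mem_downs0 => /and4P[ud id da _].
    rewrite /top_weight (negPf (notpend _ id)).
    case: d ud id da => r' c' /= ud id da; case: (eqVneq r.+1 a) => re /=; last first.
      by rewrite !andbF edge_weight_far //; lia.
    have ci : cpos K r i + 1 = cpos K a i by rewrite /cpos; lia.
    have hi : hit line U (a, cpos K r i + 1) = inU i.
      rewrite ci; apply/hitP/idP => [[k kU [/cpos_inj ->]]|]; first by rewrite /inU mem_elts.
      by case/mapP => k; rewrite mem_enum => kU ->; exists k.
    rewrite hi /final; have [r'a|r'a] := eqVneq r' a; last first.
      rewrite edge_weight_far //=; [|lia|lia].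
      case: ifP => //; case: ifP => _ /eqP[e]; last by rewrite e eqxx in r'a.
      by move: (notpend _ id); rewrite e eqxx.
    rewrite /=; case: ifP => iU /=.
      by rewrite ifN //; apply/eqP => -[]; lia.
    rewrite r'a -re edge_weight_vert ?up_cpos // re ci /line -pair_eqE /= eqxx /=.
    case: eqP => // _; rewrite /line_weight.
    have -> : [exists k in B, above a (seg k) (r, cpos K a i)] = (i \in elts B).
      apply/exists_inP/idP => [[k kB]|].
        by rewrite aboveE /= => /andP[_ /eqP/cpos_inj ->]; rewrite mem_elts.
      by case/mapP => k; rewrite mem_enum => kB ->; exists k => //; rewrite aboveE /= re !eqxx.
    have -> : ~~ odd r && (cpos K a i == 0) = odd a && (i == 0)%N by rewrite /cpos; lia.
    by [].
  + case/mapP => k; rewrite mem_enum => kU ->; rewrite /top_weight /= eqxx.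
    case: eqP => //= rE; have -> : cpos K r i + 1 = cpos K a i by rewrite /cpos; lia.
    rewrite (inj_eq (@cpos_inj K a)) /final; case: (boolP (inU i)) => iU.
      have -> : (pend (val k) == pend i) = (i == val k).
        by apply/eqP/eqP => [[/cpos_inj]|->].
      by case: eqP.
    rewrite ifN; last by apply/eqP => -[]; lia.
    by case: eqP => // e; move: iU; rewrite e /inU mem_elts kU.
Qed.

Let omega (S : {set 'I_m}) : rat := \prod_(s in S) (if odd a && (val s == 0)%N then 2^-1 else 1).

(** In [tiling_sum_top] a set [X] must contain [U], since otherwise some pendant is left over with
    no possible partner. If [X :\: U] meets [D] the exit is missing, and if it meets [B] the weight
    is 0. What remains is [X = U :|: S], and the lower half then has the dents [D :|: S]. *)
Lemma tiling_sum_split : tiling_sum N a b U D B =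
  \sum_(S : {set 'I_m} | (#|S| == y) && [disjoint S & U :|: D :|: B])
    omega S * minor K (basis a) (U :|: S) * minor K' (basis b) (D :|: S).
Proof.
have notpend t : inside N a b t -> t.1 != (a + b).+1 by case/andP; lia.
have finI (s s' : 'I_m) : final s = final s' -> s = s'.
  rewrite /final; do 2 case: ifP => _; case; try (by move/cpos_inj/val_inj); lia.
have finU (s : 'I_m) : s \in U -> final s = pend s.
  by move=> sU; rewrite /final /inU mem_elts sU.
have finN (s : 'I_m) : s \notin U -> final s = line s.
  by move=> sU; rewrite /final /inU mem_elts (negPf sU).
have uqd : uniq (downs0 ++ [seq pend s | s <- elts U]).
  rewrite uniq_catC cat_uniq uniq_triangles andbT map_inj_uniq ?uniq_elts /=; last first.
    by move=> s s' [] /cpos_inj.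
  apply/hasPn => t; rewrite mem_downs0 => /and4P[_ /notpend ti _ _].
  by apply/negP => /mapP[s _ e]; move: ti; rewrite e eqxx.
have pendN (s : 'I_m) : line s \notin [seq pend s | s <- elts U].
  by apply/negP => /mapP[k _ []]; lia.
rewrite tiling_sum_top (bigID (fun X : {set 'I_m} =>
   (U \subset X) && [disjoint X :\: U & U :|: D :|: B])) /= [X in _ + X]big1 ?addr0; last first.
  move=> X /andP[_]; rewrite negb_and => /orP[/subsetPn[s sU sX]|].
    have dm : pend s \in [seq d <- downs0 ++ [seq pend s | s <- elts U] | ~~ hit final X d].
      rewrite mem_filter mem_cat map_f ?mem_elts // orbT andbT.
      by apply/negP => /hitP[k kX]; rewrite -finU // => /finI e; rewrite e kX in sX.
    rewrite (pm_isolated (uniq_triangles _ _ _ _) (filter_uniq _ uqd) dm) ?mulr0 //.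
    move=> v; rewrite mem_ups0 => /and3P[_ _ va]; rewrite /top_weight /= eqxx.
    by rewrite (_ : (v.1.+1 == a) = false) //; apply/negbTE/eqP => h; move: va; rewrite -h ltnn.
  rewrite -setI_eq0 => /set0Pn[s]; rewrite !inE => /andP[/andP[sU sX]].
  rewrite (negPf sU) /= => sDB; rewrite (bigD1 s) //= finN // mem_cat (negPf (pendN s)) orbF.
  rewrite mem_downs0 /inU mem_elts (negPf sU) /line_weight mem_elts.
  case/orP: sDB => [sD|->]; last by case: ifP; rewrite !mul0r.
  by rewrite (_ : hit line D (line s)) ?andbF ?mul0r //; apply/hitP; exists s.
rewrite (reindex_onto (fun S => U :|: S) (fun X => X :\: U)) /=; last first.
  move=> X /and3P[_ UX _]; apply/setP => s; rewrite !inE.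
  by case: (boolP (s \in U)) => //= sU; rewrite (subsetP UX).
have disU (S : {set 'I_m}) : [disjoint S & U :|: D :|: B] ->
    [/\ [disjoint U & S], [disjoint D & S] & [disjoint B & S]].
  by rewrite disjoint_sym !disjoints_subset !subUset => /andP[/andP[]].
have DU (S : {set 'I_m}) : [disjoint U & S] -> (U :|: S) :\: U = S.
  by rewrite disjoint_sym setDUl setDv set0U => /setDidPl.
apply: eq_big => [S|S].
  apply/idP/idP => [/andP[/and3P[/eqP cX _ dis] /eqP e]|/andP[/eqP cS dis]].
    rewrite e in dis; rewrite dis andbT; have [dU _ _] := disU _ dis.
    by move/eqP: cX; rewrite cardsU (disjoint_setI0 dU) cards0 subn0 -cU eqn_add2l.
  have [dU _ _] := disU _ dis; rewrite DU // eqxx dis subsetUl !andbT.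
  by rewrite cardsU (disjoint_setI0 dU) cards0 subn0 cS cU eqxx.
case/andP => /and3P[/eqP cX _ dis] /eqP e; rewrite e in dis.
have [dU dD dB] := disU _ dis.
have cS : #|S| = y.
  by move/eqP: cX; rewrite cardsU (disjoint_setI0 dU) cards0 subn0 -cU eqn_add2l => /eqP.
have SN (s : 'I_m) : s \in S -> [/\ s \notin U, s \notin D & s \notin B].
  by move=> sS; split; apply/negP => h;
    [have := disjointFr dU h|have := disjointFr dD h|have := disjointFr dB h]; rewrite sS.
have b0 s : s \in S -> (0 < b)%N.
  by move=> sS; have : (0 < #|S|)%N by [apply/card_gt0P; exists s]; lia.
congr (_ * _ * _).
  rewrite prod_setU // big1 ?mul1r => [|s sU]; last first.
    by rewrite finU // /inU mem_elts sU mem_cat map_f ?orbT ?mem_elts.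
  apply: eq_bigr => s sS; have [sU sD sB] := SN s sS.
  rewrite finN // /inU mem_elts (negPf sU) /line_weight mem_elts (negPf sB).
  rewrite mem_cat (_ : line s \in downs0) // mem_downs0.
  rewrite (andbA (~~ up _)) (inside_down_bot Ka NK Kb ab Km) // leqnn /=.
  have bb := b0 s sS; rewrite (_ : hit line D _ = false) ?andbT; last first.
    by apply/hitP => -[k kD [/cpos_inj/val_inj sk]]; rewrite sk kD in sD.
  rewrite -{1}(addn0 a) ltn_add2l bb -subn1 subnAC addKn subn1 (cpos_parity _ Ka Kb ab) /=.
  exact: up_cell_last.
have cDS : #|D :|: S| = K' by rewrite cardsU (disjoint_setI0 dD) cards0 subn0 cS.
rewrite -(@bottom_sum N a b m K K' B (D :|: S)) //.
have -> : [seq d <- downs0 ++ [seq pend s | s <- elts U] | ~~ hit final (U :|: S) d] =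
   triangles N a b (fun t => [&& ~~ up t, inside N a b t, (a <= t.1)%N
      & ~~ hit (fun s => (a, cpos K a s)) (D :|: S) t]).
  rewrite filter_cat [X in _ ++ X](_ : _ = [::]) ?cats0; last first.
    apply/eqP; rewrite -[_ == _]negbK -has_filter; apply/hasPn => t /mapP[s].
    case/mapP => k; rewrite mem_enum => kU -> ->; rewrite negbK; apply/hitP.
    by exists k; rewrite ?finU // inE kU.
  rewrite -filter_predI; apply: eq_filter => t /=.
  case: (up t) => /=; rewrite ?andbF //; case: (boolP (inside N a b t)) => it /=;
    rewrite ?andbF //; case: (a <= t.1)%N => /=; rewrite ?andbF // -negb_or orbC.
  congr (~~ _); apply/orP/hitP.
    case=> /hitP[k kX e']; exists k => //; first by rewrite inE kX.
      move: kX; rewrite !inE => /orP[kU|->]; last by rewrite orbT.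
      by move: (notpend _ it); rewrite e' finU // eqxx.
    move: kX; rewrite inE => /orP[kU|kS].
      by move: (notpend _ it); rewrite e' finU // eqxx.
    by have [kU _ _] := SN k kS; rewrite e' finN.
  case=> k; rewrite inE => /orP[kD|kS] e'; first by left; apply/hitP; exists k.
  have [kU _ _] := SN k kS.
  by right; apply/hitP; exists k; rewrite ?inE ?kS ?orbT ?finN.
apply: eq_pm => t s; rewrite mem_ups0 => /and3P[_ _ ta].
rewrite mem_triangles => [/and4P[_ /notpend/negPf s1 _ _]|s' /and4P[] //].
rewrite /top_weight s1 ifN //; apply/negP => /and3P[_ /eqP h _].
by move: ta; rewrite -h ltnn.
Qed.

End Top.

(** * Factorization of the tiling sum *)

Lemma dent_prod_gt0 m e (V : {set 'I_m}) : 0 < dent_prod e V.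
Proof. by rewrite mulr_gt0 ?vdm_gt0 ?diag_gt0. Qed.

Lemma dent_prodU m e (U S : {set 'I_m}) : [disjoint U & S] ->
  dent_prod e (U :|: S) =
  dent_prod e U * dent_prod e S * \prod_(j in S) \prod_(i in U) gap e i j.
Proof. by move=> dis; rewrite /dent_prod vdmU // diagU //; ring. Qed.

(* The part of the tiling sum depending only on [W = U :|: D] and [I = U :&: D]. *)
Definition crossing_sum m (o : bool) (y : nat) (W I B : {set 'I_m}) : rat :=
  \sum_(S : {set 'I_m} | (#|S| == y) && [disjoint S & W :|: B])
    (\prod_(s in S) (if o && (val s == 0)%N then 2^-1 else 1)) * dent_prod (~~ o) S ^+ 2 *
    \prod_(j in S) ((\prod_(i in W) gap (~~ o) i j) * (\prod_(i in I) gap (~~ o) i j)).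

Lemma crossing_sum_gt0 m o y (W I B : {set 'I_m}) : I \subset W ->
  (y + #|W :|: B| <= m)%N -> 0 < crossing_sum o y W I B.
Proof.
move=> IW le_m.
have term_gt0 (S : {set 'I_m}) : [disjoint S & W :|: B] ->
   0 < (\prod_(s in S) (if o && (val s == 0)%N then 2^-1 else 1)) * dent_prod (~~ o) S ^+ 2 *
    \prod_(j in S) ((\prod_(i in W) gap (~~ o) i j) * (\prod_(i in I) gap (~~ o) i j)).
  move=> dis; apply: mulr_gt0.
    apply: mulr_gt0; last by rewrite exprn_gt0 ?dent_prod_gt0.
    by apply: prodr_gt0 => s _; case: ifP; rewrite ?invr_gt0.
  have ne (i j : 'I_m) : i \in W -> j \in S -> val i != val j.
    move=> iW jS; apply/eqP => /val_inj e.
    by move: (disjointFr dis jS); rewrite inE -e iW.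
  apply: prodr_gt0 => j jS; apply: mulr_gt0; apply: prodr_gt0 => i iI; apply: gap_gt0.
    exact: ne.
  by apply: ne => //; apply: (subsetP IW).
(* The size hypothesis leaves at least [y] slots outside [W :|: B]; any [y] of them give a positive
   term. *)
pose S := [set s in take y (enum (~: (W :|: B)))].
have cS : #|S| = y.
  rewrite cardsE; have /card_uniqP -> : uniq (take y (enum (~: (W :|: B)))).
    by rewrite take_uniq ?enum_uniq.
  rewrite size_take_min -cardE; apply/minn_idPl.
  by rewrite -(leq_add2l #|W :|: B|) cardsC card_ord addnC.
have dS : [disjoint S & W :|: B].
  rewrite disjoints_subset; apply/subsetP => s; rewrite inE => /mem_take.
  by rewrite mem_enum.
rewrite /crossing_sum (bigD1 S) /= ?cS ?eqxx ?dS // ltr_wpDr ?term_gt0 //.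
by apply: sumr_ge0 => S' /andP[/andP[_ dis] _]; apply/ltW/term_gt0.
Qed.

Lemma tiling_sum_factor N a b m K K' y (U D B : {set 'I_m}) :
  uphalf a = K -> uphalf b = K' -> odd a = odd b -> (N + K = m)%N -> (K' <= m)%N ->
  (#|U| + y = K)%N -> (#|D| + y = K')%N ->
  tiling_sum N a b U D B =
  norm_const (~~ odd a) K * norm_const (~~ odd a) K' *
  (dent_prod (~~ odd a) U * dent_prod (~~ odd a) D) *
  crossing_sum (odd a) y (U :|: D) (U :&: D) B.
Proof.
move=> Ka Kb ab NK Km cU cD; rewrite (tiling_sum_split B Ka Kb ab NK Km cU cD) mulr_sumr.
apply: eq_bigr => S /andP[/eqP cS dis].
have [dU dD] : [disjoint U & S] /\ [disjoint D & S].
  by move: dis; rewrite disjoint_sym !disjoints_subset !subUset => /andP[/andP[-> ->]].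
rewrite !minor_basis; first last.
- by rewrite cardsU (disjoint_setI0 dU) cards0 subn0 cS.
- by rewrite cardsU (disjoint_setI0 dD) cards0 subn0 cS.
rewrite -ab !dent_prodU // big_split /=.
have -> : (\prod_(j in S) \prod_(i in U :|: D) gap (~~ odd a) i j) *
          (\prod_(j in S) \prod_(i in U :&: D) gap (~~ odd a) i j) =
          (\prod_(j in S) \prod_(i in U) gap (~~ odd a) i j) *
          (\prod_(j in S) \prod_(i in D) gap (~~ odd a) i j).
  by rewrite -[LHS]big_split -[RHS]big_split; apply: eq_bigr => j _; apply/esym/prod_setUI.
by ring.
Qed.

Lemma H2_gt0 k : 0 < H2 k.
Proof. by apply: prodr_gt0 => i _; rewrite ltr0n fact_gt0. Qed.

Theorem theorem3p2 (x y n : nat) (U D U' D' B : {set 'I_(x + y + n)}) :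
  #|U :|: D| = n ->
  U :|: D = U' :|: D' ->
  U :&: D = U' :&: D' ->
  B \subset ~: (U :|: D) ->
  (#|B| <= x)%N ->
  MW U D B / MW U' D' B =
    (prod_sub U * prod_add1 U * prod_sub D * prod_add1 D) /
    (prod_sub U' * prod_add1 U' * prod_sub D' * prod_add1 D') *
    ((H2 (2 * #|U'| + 2 * y + 1)%N * H2 (2 * #|D'| + 2 * y + 1)%N) /
     (H2 (2 * #|U| + 2 * y + 1)%N * H2 (2 * #|D| + 2 * y + 1)%N))
  /\
  (Wbar_defined y U D -> Wbar_defined y U' D' ->
   MWbar U D B / MWbar U' D' B =
    (prod_sub_add2 U * prod_sub_add2 D) /
    (prod_sub_add2 U' * prod_sub_add2 D') *
    ((H2 (2 * #|U'| + 2 * y)%N * H2 (2 * #|D'| + 2 * y)%N) /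
     (H2 (2 * #|U| + 2 * y)%N * H2 (2 * #|D| + 2 * y)%N))).
Proof.
move=> cUD eU eI BUD Bx.
have leU : (#|U| <= n)%N by move: (subset_leq_card (subsetUl U D)); rewrite cUD.
have leD : (#|D| <= n)%N by move: (subset_leq_card (subsetUr U D)); rewrite cUD.
have leU' : (#|U'| <= n)%N by move: (subset_leq_card (subsetUl U' D')); rewrite -eU cUD.
have leD' : (#|D'| <= n)%N by move: (subset_leq_card (subsetUr U' D')); rewrite -eU cUD.
have X0 o : crossing_sum o y (U :|: D) (U :&: D) B != 0.
  apply/lt0r_neq0/crossing_sum_gt0.
    by apply/subsetP => s; rewrite !inE => /andP[->].
  (* Of the x + y + n segments at least [y] are then free for [S]. *)
  have : (#|U :|: D :|: B| <= n + x)%N.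
    by rewrite (leq_trans (leq_card_setU _ _).1) // cUD leq_add2l.
  lia.
(* Needed for the powers of 2 in [norm_const_even]: the total number of dents is the same on both
   sides, so they cancel. *)
have cUI : (#|U| + #|D| = #|U'| + #|D'|)%N by rewrite -cardsUI eU eI cardsUI.
have H0 k : H2 k != 0 by rewrite lt0r_neq0 ?H2_gt0.
have P0 e (V : {set 'I_(x + y + n)}) : dent_prod e V != 0 by rewrite lt0r_neq0 ?dent_prod_gt0.
have two0 k : 2 ^+ k != 0 :> rat by rewrite expf_neq0.
split.
  have MWE (A C : {set 'I_(x + y + n)}) : (#|A| <= n)%N -> (#|C| <= n)%N -> MW A C B =
    (2 ^+ (#|A| + #|C| + 2 * y) * (H2 (2 * #|A| + 2 * y + 1) * H2 (2 * #|C| + 2 * y + 1)))^-1 *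
    (prod_sub A * prod_add1 A * prod_sub C * prod_add1 C) *
    crossing_sum false y (A :|: C) (A :&: C) B.
    move=> leA leC.
    rewrite /MW (@tiling_sum_factor _ _ _ _ (#|A| + y) (#|C| + y) y); try lia.
    have -> : odd (2 * y + 2 * #|A|) = false by lia.
    rewrite /= !norm_const_even -[prod_sub A * _ * _ * _]mulrA !prod_sub_add1E !mulnDr.
    congr (_ * _ * _); rewrite -invfM; congr (_^-1).
    rewrite (_ : #|A| + #|C| + 2 * y = (#|A| + y) + (#|C| + y))%N; last lia.
    by rewrite [in RHS]exprD; ring.
  rewrite !MWE // -eU -eI -cUI.
  rewrite -[prod_sub U * _ * _ * _]mulrA -[prod_sub U' * _ * _ * _]mulrA !prod_sub_add1E.
  by field; rewrite ?X0 ?H0 ?P0 ?two0.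
move=> /andP[dU dD] /andP[dU' dD'].
have MWE (A C : {set 'I_(x + y + n)}) : (#|A| <= n)%N -> (#|C| <= n)%N ->
    (1 <= 2 * y + 2 * #|A|)%N -> (1 <= 2 * y + 2 * #|C|)%N -> MWbar A C B =
    (H2 (2 * #|A| + 2 * y) * H2 (2 * #|C| + 2 * y))^-1 *
    (prod_sub_add2 A * prod_sub_add2 C) * crossing_sum true y (A :|: C) (A :&: C) B.
  move=> leA leC dA dC.
  rewrite /MWbar (@tiling_sum_factor _ _ _ _ (#|A| + y) (#|C| + y) y); try lia.
  have -> : odd (2 * y + 2 * #|A| - 1) = true by lia.
  by rewrite /= !norm_const_odd !prod_sub_add2E !mulnDr -invfM.
rewrite !MWE // -eU -eI !prod_sub_add2E.
by field; rewrite ?X0 ?H0 ?P0.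
Qed.
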